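(* Let $0\le f\in L^1[-\pi,\pi]$ (not a.e. zero) and let $f^\#$ be its symmetric decreasing rearrangement. Then \[\int_{-\pi}^{\pi}\phi\bigl(u_f(x)\bigr)\,dx\le\int_{-\pi}^{\pi}\phi\bigl(u_{f^\#}(x)\bigr)\,dx\] for every convex and increasing $\phi:\mathbb{R}\to\mathbb{R}$; equivalently $u_f^\star(t)\le u_{f^\#}^\star(t)$ for all $t\in[0,2\pi]$. Furthermore, if $\phi$ is strictly increasing (and convex), equality holds if and only if $f=f^\#$ a.e. on $(-\pi,\pi)$.
   Context: $\lambda$ is Lebesgue measure. $G(x,y)=-\frac{xy}{2\pi}-\frac12|x-y|+\frac{\pi}{2}$ on $[-\pi,\pi]^2$, $u_g(x)=\int_{-\pi}^\pi G(x,y)g(y)\,dy$ (solution of $-u''=g$ on $(-\pi,\pi)$, $u(\pm\pi)=0$). Decreasing rearrangement: $f^*(t)=\inf\{s:\lambda(\{x\in[-\pi,\pi]:f(x)>s\})\le t\}$ for $t\in(0,2\pi)$, $f^*(0)=\operatorname{ess\,sup}f$, $f^*(2\pi)=\operatorname{ess\,inf}f$; $f^\#(t)=f^*(2|t|)$ on $[-\pi,\pi]$. Star function: $g^\star(t)=\sup\{\int_E g\,d\lambda:E\subset[-\pi,\pi]\text{ Borel},\lambda(E)=t\}$. *)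

(* Defs.v *)
From HB Require Import structures.
From mathcomp Require Import all_boot all_order all_algebra.
From mathcomp Require Import all_classical all_reals all_analysis.
Set Implicit Arguments. Unset Strict Implicit. Unset Printing Implicit Defensive.
Import Order.TTheory GRing.Theory Num.Theory.
Import numFieldNormedType.Exports.
Local Open Scope classical_set_scope.
Local Open Scope ring_scope.

Section defs.
Variable R : realType.

Notation lam := (@lebesgue_measure R).

Definition Ipi : set R := `[- pi, pi]%classic.

Definition Green (x y : R) : R := - (x * y) / (2 * pi) - `|x - y| / 2 + pi / 2.

Definition ug (g : R -> R) (x : R) : R := Rintegral lam Ipi (fun y => Green x y * g y).

Definition ess_sup_Ipi (f : R -> R) : \bar R :=
  ereal_inf [set y : \bar R | {ae lam, forall x, Ipi x -> ((f x)%:E <= y)%E}].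
Definition ess_inf_Ipi (f : R -> R) : \bar R :=
  ereal_sup [set y : \bar R | {ae lam, forall x, Ipi x -> (y <= (f x)%:E)%E}].

Definition drearr (f : R -> R) (t : R) : R :=
  if t == 0 then fine (ess_sup_Ipi f)
  else if t == 2 * pi then fine (ess_inf_Ipi f)
  else inf [set s : R | (lam (Ipi `&` [set x | (s < f x)%R]) <= t%:E)%E].

Definition sdrearr (f : R -> R) (t : R) : R := drearr f (2 * `|t|).

Definition star (g : R -> R) (t : R) : \bar R :=
  ereal_sup [set (\int[lam]_(x in E) (g x)%:E)%E | E in
     [set E : set R | measurable E /\ E `<=` Ipi /\ lam E = t%:E]].

Definition convex_fun (phi : R -> R) : Prop :=
  forall (x y l : R), 0 <= l -> l <= 1 ->
    phi (l * x + (1 - l) * y) <= l * phi x + (1 - l) * phi y.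

End defs.

(* Main.v *)
(* Write u_g for ug g.  If a <= b, a suitable convex combination of u_f(a) and
   u_f(b) is the integral of f against a trapezoid, flat on [a, b], whose
   superlevel sets are no longer than those of the symmetric trapezoid
   (pi - max(|r|, |y|)) / 2 with r = (b - a) / 2.  The Hardy-Littlewood
   inequality then gives min(u_f(a), u_f(b)) <= u_{f#}(r).  Since u_{f#} is even
   and decreasing in |x|, every superlevel set of u_{f#} contains a centred
   interval as long as the corresponding set of u_f is wide, which yields both
   inequalities.

   For the equality case, phi minus a multiple of the identity is still
   nondecreasing on [0, +oo[, so equality forces u_f and u_{f#} to have the same
   mean.  This mean is the integral of f against the torsion function, which is
   strictly decreasing in |x|; hence for almost every t the set {f > t} is the
   centred interval {f# > t} up to a null set. *)
Require Import Defs.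
From HB Require Import structures.
From mathcomp Require Import all_boot all_order all_algebra.
From mathcomp Require Import all_classical all_reals all_analysis.
From mathcomp Require Import measurable_realfun ring lra.
Set Implicit Arguments. Unset Strict Implicit. Unset Printing Implicit Defensive.
Import Order.TTheory GRing.Theory Num.Theory.
Import numFieldNormedType.Exports.
Local Open Scope classical_set_scope.
Local Open Scope ring_scope.

(** The geometry is carried by pairs of points, so no superlevel set of a potential has to be
    identified as an interval. A set of measure l contains two points farther apart than any given m
    < l, and a bound on the minimum of two values then places a centred interval of length m in the
    comparison set. Such a bound on minima survives composition with a nondecreasing function. The
    same rearrangement lemma can therefore be used twice: first for the kernel against the density,
    then for the potential (or a nondecreasing function of it) against the indicator of a set.

    The rearrangement enters only through the equivalence of t < f#(x) with 2|x| < lam{f > t}, never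
    through its formula. That equivalence can fail at 0 and at the two endpoints, so [f] and
    [sdrearr f] are replaced by functions that vanish at these points and outside the interval. This
    is why the centre is excepted ([x != 0]) in the hypotheses below. *)

Lemma measurable_setP d (T : measurableType d) (P : T -> bool) :
  measurable_fun [set: T] P -> measurable [set x | P x].
Proof.
move=> mP; have := mP measurableT [set true] I; rewrite setTI.
by congr (measurable _); apply/seteqP; split => x /= ->.
Qed.

Lemma measurable_bool_natr (R : realType) d (T : measurableType d) (P : T -> bool) :
  measurable_fun [set: T] P -> measurable_fun [set: T] (fun x => (P x)%:R : R).
Proof.
move=> mP; rewrite (_ : (fun _ => _) = \1_[set x | P x] :> (T -> R)).
  exact: measurable_indic (measurable_setP mP).
apply/funext => x; rewrite indicE; congr (_%:R); congr nat_of_bool.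
by apply/idP/idP => [?|/set_mem//]; exact/mem_set.
Qed.

Lemma integral_bool_natr (R : realType) d (T : measurableType d)
    (m : {measure set T -> \bar R}) (P : T -> bool) :
  measurable_fun [set: T] P ->
  (\int[m]_x ((P x)%:R)%:E = m [set x | P x])%E.
Proof.
move=> mP; have := integral_indic m measurableT (measurable_setP mP); rewrite setIT => <-.
apply: eq_integral => x _; rewrite indicE; congr (_%:R%:E); congr nat_of_bool.
by apply/idP/idP => [?|/set_mem//]; exact/mem_set.
Qed.

(** * Layer-cake formulas and integrals of products *)

Section layer_cake.
Context {R : realType}.
Local Notation lam := (@lebesgue_measure R).
Implicit Types f g h k K : R -> R.

Let measurable_slice f h : measurable_fun setT f -> measurable_fun setT h ->
  measurable_fun setT (fun p : R * R => (h p.1 <= p.2) && (p.2 < f p.1)).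
Proof.
move=> mf mh; apply: measurable_and.
  by apply: measurable_fun_ler => //; exact: measurableT_comp.
by apply: measurable_fun_ltr => //; exact: measurableT_comp.
Qed.

Let measurable_slab_integrand k f h : measurable_fun setT k -> measurable_fun setT f ->
  measurable_fun setT h ->
  measurable_fun setT (fun p : R * R =>
    (k p.1 * ((h p.1 <= p.2) && (p.2 < f p.1))%:R)%:E).
Proof.
move=> mk mf mh; apply/measurable_EFinP => /=; apply: measurable_funM.
  exact: measurableT_comp.
exact: measurable_bool_natr (measurable_slice mf mh).
Qed.

Lemma measurable_slab_integral k f h : measurable_fun setT k ->
  measurable_fun setT f -> measurable_fun setT h -> (forall x, 0 <= k x) ->
  measurable_fun setT (fun t => (\int[lam]_x
    (k x * ((h x <= t) && (t < f x))%:R)%:E)%E).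
Proof.
move=> mk mf mh k0.
have := @measurable_fun_fubini_tonelli_G _ _ _ _ _ lam _ (measurable_slab_integrand mk mf mh).
by apply=> p; rewrite lee_fin mulr_ge0.
Qed.

(** For fixed [x] the heights [t] with [h x <= t < f x] form an interval of length
    [Num.max (f x - h x) 0]; Tonelli does the rest. The lower function [h] is 0 in the rearrangement
    inequality, and a competing density in the equality case. *)
Lemma layer_cake k f h : measurable_fun setT k -> measurable_fun setT f ->
  measurable_fun setT h -> (forall x, 0 <= k x) ->
  (\int[lam]_x (k x * Num.max (f x - h x) 0)%:E =
   \int[lam]_t \int[lam]_x (k x * ((h x <= t) && (t < f x))%:R)%:E)%E.
Proof.
move=> mk mf mh k0.
rewrite -(@fubini_tonelli _ _ _ _ _ lam lam _ (measurable_slab_integrand mk mf mh))/=;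
  last first.
  by move=> p; rewrite lee_fin mulr_ge0.
apply: eq_integral => x _.
under eq_integral do rewrite EFinM.
have mP : measurable_fun setT (fun t : R => h x <= t < f x).
  by apply: measurable_and; [exact: measurable_fun_ler|exact: measurable_fun_ltr].
rewrite ge0_integralZl//.
- rewrite integral_bool_natr//.
  rewrite EFinM; congr (_ * _)%E.
  rewrite (_ : [set t | _] = `[h x, f x[%classic); last first.
    by apply/seteqP; split => t /=; rewrite in_itv.
  transitivity (lam `[h x, f x[%classic); last by [].
  rewrite lebesgue_measure_itv/= lte_fin; case: ltP => hf.
    by rewrite max_l// subr_ge0 ltW.
  by rewrite max_r// subr_le0.
- by apply/measurable_EFinP; exact: measurable_bool_natr.
- by rewrite lee_fin.
Qed.

Let layer_cake0 k f : measurable_fun setT k -> measurable_fun setT f ->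
  (forall x, 0 <= k x) -> (forall x, 0 <= f x) ->
  (\int[lam]_x (k x * f x)%:E =
   \int[lam]_t \int[lam]_x (k x * ((0 <= t) && (t < f x))%:R)%:E)%E.
Proof.
move=> mk mf k0 f0; rewrite -(@layer_cake k f (cst 0))//.
by apply: eq_integral => x _; rewrite subr0 max_l.
Qed.

(** The layer cake is applied twice, to [f] with weight [K] and then to [K] with the indicator of a
    level of [f] as weight. This leaves the measure of a joint superlevel set, integrated over both
    heights. *)
Lemma le_integral_levels K f K0 f0 :
  measurable_fun setT K -> measurable_fun setT f ->
  measurable_fun setT K0 -> measurable_fun setT f0 ->
  (forall x, 0 <= K x) -> (forall x, 0 <= f x) ->
  (forall x, 0 <= K0 x) -> (forall x, 0 <= f0 x) ->
  (forall s t : R, (0 <= s)%R -> (0 <= t)%R ->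
    lam [set x | (s < K x)%R && (t < f x)%R] <=
    lam [set x | (s < K0 x)%R && (t < f0 x)%R])%E ->
  (\int[lam]_x (K x * f x)%:E <= \int[lam]_x (K0 x * f0 x)%:E)%E.
Proof.
move=> mK mf mK0 mf0 K_ge0 f_ge0 K0_ge0 f0_ge0 level.
have slice g t : measurable_fun setT g ->
    measurable_fun setT (fun x => (0 <= t) && (t < g x)).
  by move=> mg; apply: measurable_and => /=; [exact: measurable_cst|exact: measurable_fun_ltr].
(* The factors trade roles: the indicator of the level set of [g] becomes the weight, and [k] is
   sliced in its turn. *)
have swap k g t : measurable_fun setT k -> measurable_fun setT g ->
    (forall x, 0 <= k x) ->
    (\int[lam]_x (k x * ((0 <= t) && (t < g x))%:R)%:E =
     \int[lam]_s \int[lam]_x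
       (((0 <= t) && (t < g x))%:R * ((0 <= s) && (s < k x))%:R)%:E)%E.
  move=> mk mg k0; rewrite -layer_cake0//; last exact: measurable_bool_natr (slice _ _ mg).
  by apply: eq_integral => x _; rewrite mulrC.
rewrite !layer_cake0//; apply: ge0_le_integral => //.
- by move=> t _; apply: integral_ge0 => x _; rewrite lee_fin mulr_ge0.
- exact: measurable_slab_integral.
- exact: measurable_slab_integral.
move=> t _; rewrite !swap//; apply: ge0_le_integral => //.
- by move=> s _; apply: integral_ge0 => x _; rewrite lee_fin mulr_ge0.
- by apply: measurable_slab_integral => //; exact: measurable_bool_natr (slice _ _ mf).
- by apply: measurable_slab_integral => //; exact: measurable_bool_natr (slice _ _ mf0).
move=> s _.
under eq_integral do rewrite -natrM mulnb.
under [leRHS]eq_integral do rewrite -natrM mulnb.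
have [s0|s0] := leP 0 s; last first.
  by under eq_integral do rewrite andbF; under [leRHS]eq_integral do rewrite andbF.
have [t0|t0] := leP 0 t; last first.
  by under eq_integral do rewrite /=; under [leRHS]eq_integral do rewrite /=.
rewrite /= !integral_bool_natr//; try by apply: measurable_and; apply: measurable_fun_ltr.
have E g k : [set x | (t < g x) && (s < k x)] =
    [set x | (s < k x) && (t < g x)] :> set R.
  by apply/seteqP; split => x /=; rewrite andbC.
by rewrite !E; exact: level.
Qed.

End layer_cake.

(** * A rearrangement inequality obtained from distances between points *)

Section rearrangement.
Context {R : realType}.
Local Notation lam := (@lebesgue_measure R).
Implicit Types (f g h k K : R -> R) (A S : set R).

Lemma le_lebesgue_measure A S : measurable A -> measurable S -> A `<=` S ->
  (lam A <= lam S)%E.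
Proof. by move=> mA mS AS; apply: le_measure => //; rewrite inE. Qed.

Lemma lebesgue_measureDI A S : measurable A -> measurable S ->
  (lam A = lam (A `\` S) + lam (A `&` S))%E.
Proof. by move=> mA mS; rewrite -(measureDI lam mA mS). Qed.

Lemma measurable_superlevel g (t : R) : measurable_fun setT g ->
  measurable [set x | t < g x].
Proof.
move=> mg; apply: (@measurable_setP _ _ (fun x => t < g x)).
exact: measurable_fun_ltr.
Qed.

(** Such a set lies in the interval of length [m] that starts at its infimum. *)
Lemma lebesgue_measure_diam A (m : R) : measurable A -> 0 <= m ->
  (forall a b, A a -> A b -> a <= b -> b - a <= m) -> (lam A <= m%:E)%E.
Proof.
move=> mA m0 Am; have [->|/set0P[a0 Aa0]] := eqVneq A set0; first by rewrite measure0.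
have hA a b : A a -> A b -> b - m <= a.
  move=> Aa Ab; have [ab|/ltW ba] := leP a b; first by have := Am _ _ Aa Ab ab; lra.
  lra.
have infA : has_inf A by split; [exists a0|exists (a0 - m) => x Ax; exact: hA].
have AI : A `<=` `[inf A, inf A + m]%classic.
  move=> x Ax /=; rewrite in_itv/=; apply/andP; split; first exact: (ge_inf infA.2).
  rewrite -lerBlDr; apply: lb_le_inf; first by exists a0.
  by move=> y Ay; exact: hA.
apply: (le_trans (le_lebesgue_measure mA (measurable_itv _) AI)).
rewrite lebesgue_measure_itv/= lte_fin; case: ifP => _; last by rewrite lee_fin.
by rewrite -EFinD lee_fin; lra.
Qed.

(* The hypothesis says that S contains the centred interval whose length is
   min(diam A, 2c), up to its centre. *)
Lemma lebesgue_measure_le_centered A S (c : R) :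
  measurable A -> measurable S -> (lam A <= (2 * c)%:E)%E ->
  (forall a b x, A a -> A b -> a <= b -> `|x| <= (b - a) / 2 -> x != 0 ->
    `|x| < c -> S x) ->
  (lam A <= lam S)%E.
Proof.
move=> mA mS Ac AS; rewrite leNgt; apply/negP => SA.
have Afin : lam A \is a fin_num by rewrite ge0_fin_numE//; exact: le_lt_trans Ac (ltry _).
have Sfin : lam S \is a fin_num.
  by rewrite ge0_fin_numE//; apply: lt_trans SA _; rewrite -ge0_fin_numE.
move: SA Ac; rewrite -(fineK Afin) -(fineK Sfin) lte_fin lee_fin.
set l := fine (lam A); set s := fine (lam S) => sl lc.
have s0 : 0 <= s by rewrite fine_ge0.
(* The midpoint leaves room on both sides: below the measure of [A], so two points of [A] are more
   than [m] apart; above the measure of [S], so a centred interval of length [m] cannot fit in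
   [S]. *)
pose m := (s + l) / 2.
have [a [b [Aa Ab ab mab]]] : exists a b, [/\ A a, A b, a <= b & m < b - a].
  apply/not_existsP => H.
  have : (lam A <= m%:E)%E.
    apply: lebesgue_measure_diam => //; first by rewrite /m; lra.
    move=> a b Aa Ab ab; rewrite leNgt; apply/negP => mba; apply: (H a).
    by exists b.
  by rewrite -(fineK Afin) lee_fin -/l /m; lra.
(* The origin is added by hand because [AS] says nothing about it; it costs no measure. *)
have IS : `]- (m / 2), m / 2[%classic `<=` S `|` [set 0].
  move=> x /=; rewrite in_itv/= => /andP[x1 x2].
  have xm : `|x| < m / 2 by rewrite ltr_norml x1.
  have [->|x0] := eqVneq x 0; first by right.
  left; apply: (AS a b) => //; first by apply: ltW; apply: lt_trans xm _; lra.
  by apply: lt_trans xm _; rewrite /m; lra.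
have mU : measurable (S `|` [set 0]) by exact: measurableU.
have U2 : (lam (S `|` [set (0%R : R)]) <= lam S + lam [set (0%R : R)])%E.
  exact: (measureU2 lam mS (measurable_set1 0)).
have := le_trans (le_lebesgue_measure (measurable_itv _) mU IS) U2.
rewrite lebesgue_measure_set1 adde0 lebesgue_measure_itv/= lte_fin.
rewrite ifT; last by rewrite /m; lra.
by rewrite -EFinD -(fineK Sfin) lee_fin -/s /m; lra.
Qed.

(** Two points of a joint superlevel set of [K] and [f] put a centred interval as long as their
    distance in the level of [K0], while [ff0] puts the centred interval of length [lam {f > t}] in
    that of [f0]. So [lebesgue_measure_le_centered] applies with [c] half that measure. Restricting
    the condition on [K] to points with [f > 0] keeps those points inside the support of the
    density. *)
Lemma riesz_rearrangement K f K0 f0 :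
  measurable_fun setT K -> measurable_fun setT f ->
  measurable_fun setT K0 -> measurable_fun setT f0 ->
  (forall x, 0 <= K x) -> (forall x, 0 <= f x) ->
  (forall x, 0 <= K0 x) -> (forall x, 0 <= f0 x) ->
  (lam [set x | 0 < f x]%R < +oo)%E ->
  (forall a b x, 0 < f a -> 0 < f b -> a <= b -> `|x| <= (b - a) / 2 ->
    Num.min (K a) (K b) <= K0 x) ->
  (forall t x, 0 <= t -> x != 0 ->
    ((2 * `|x|)%:E < lam [set y | t < f y]%R)%E -> t < f0 x) ->
  (\int[lam]_x (K x * f x)%:E <= \int[lam]_x (K0 x * f0 x)%:E)%E.
Proof.
move=> mK mf mK0 mf0 K_ge0 f_ge0 K0_ge0 f0_ge0 ffin KK0 ff0.
have mlt2 g h s t : measurable_fun setT g -> measurable_fun setT h ->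
    measurable [set x | (s < g x) && (t < h x)].
  move=> mg mh; apply: (@measurable_setP _ _ (fun x => (s < g x) && (t < h x))).
  by apply: measurable_and; exact: measurable_fun_ltr.
apply: le_integral_levels => // s t s0 t0.
have ft_fin : lam [set y | t < f y] \is a fin_num.
  rewrite ge0_fin_numE//; apply: le_lt_trans ffin.
  by apply: le_lebesgue_measure; [exact: measurable_superlevel..|move=> x /=; exact: le_lt_trans].
apply: (@lebesgue_measure_le_centered _ _ (fine (lam [set y | t < f y]) / 2)).
- exact: mlt2.
- exact: mlt2.
- rewrite mulrC divfK// fineK//; apply: le_lebesgue_measure;
    [exact: mlt2|exact: measurable_superlevel|].
  by move=> x /= /andP[].
move=> a b x /= /andP[sKa tfa] /andP[sKb tfb] ab xab x0 xc.
apply/andP; split.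
  apply: lt_le_trans (KK0 a b x _ _ ab xab); first by rewrite lt_min sKa.
  - exact: le_lt_trans tfa.
  - exact: le_lt_trans tfb.
apply: ff0 => //; rewrite -(fineK ft_fin) lte_fin; lra.
Qed.

End rearrangement.

(** * The Green function and its even part *)

Section green.
Context {R : realType}.
Local Notation lam := (@lebesgue_measure R).
Local Notation Ipi := (@Ipi R).
Local Notation Green := (@Green R).
Implicit Types (f g h : R -> R) (x y : R).

Lemma GreenC x y : Green x y = Green y x.
Proof. by rewrite /Green (mulrC x) distrC. Qed.

(** [Green] is the minimum of two bilinear branches, and each branch bounds it from above
    everywhere. These bounds become the sides and the top of the trapezoid. *)
Lemma Green_le_left x y : Green x y <= (pi + y) * (pi - x) / (2 * pi).
Proof.
have p0 := pi_gt0 R.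
rewrite -subr_ge0 (_ : _ - _ = (`|x - y| - (x - y)) / 2); last first.
  by rewrite /Green; field; lra.
by rewrite divr_ge0// subr_ge0 ler_norm.
Qed.

Lemma Green_le_right x y : Green x y <= (pi - y) * (pi + x) / (2 * pi).
Proof. by rewrite GreenC [(pi - y) * _]mulrC; exact: Green_le_left. Qed.

Lemma Green_left_eq x y : y <= x -> Green x y = (pi + y) * (pi - x) / (2 * pi).
Proof.
by move=> yx; have p0 := pi_gt0 R; rewrite /Green ger0_norm ?subr_ge0//; field; lra.
Qed.

Lemma IpiP x : Ipi x <-> - pi <= x <= pi.
Proof. by rewrite /Defs.Ipi /= in_itv. Qed.

Lemma measurable_Ipi : measurable Ipi.
Proof. exact: measurable_itv. Qed.

Lemma Green_ge0 x y : Ipi x -> Ipi y -> 0 <= Green x y.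
Proof.
have p0 := pi_gt0 R; move=> /IpiP/andP[x1 x2] /IpiP/andP[y1 y2].
wlog yx : x y x1 x2 y1 y2 / y <= x.
  by move=> H; have [/H->//|/ltW/H] := leP y x; rewrite GreenC; apply.
by rewrite Green_left_eq// divr_ge0 ?mulr_ge0//; lra.
Qed.

Lemma Green_le_pi x y : Ipi x -> Ipi y -> Green x y <= pi.
Proof.
have p0 := pi_gt0 R; move=> /IpiP/andP[x1 x2] /IpiP/andP[y1 y2].
rewrite /Green (le_trans (_ : _ <= (pi ^+ 2 - x * y) / (2 * pi)))//.
  have := normr_ge0 (x - y).
  rewrite (_ : (pi ^+ 2 - x * y) / (2 * pi) = - (x * y) / (2 * pi) + pi / 2); last first.
    by field; lra.
  lra.
by rewrite ler_pdivrMr; nra.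
Qed.

Lemma Green_boundary x y : `|x| = pi -> Ipi y -> Green x y = 0.
Proof.
have p0 := pi_gt0 R; move=> xp /IpiP/andP[y1 y2].
have [x0|x0] := leP 0 x.
  rewrite ger0_norm// in xp; rewrite Green_left_eq xp//; lra.
rewrite ltr0_norm// in xp; rewrite GreenC Green_left_eq; last lra.
by rewrite (_ : pi + x = 0) ?mul0r//; lra.
Qed.

(** The even part of [Green x] on the interval, that is, the kernel that an even density sees;
    truncated at 0 to be nonnegative on the whole line. *)
Definition Green_sym x y : R := Num.max ((pi - Num.max `|x| `|y|) / 2) 0.

Lemma Green_symE x y : Ipi x -> Ipi y ->
  Green_sym x y = (Green x y + Green (- x) y) / 2.
Proof.
have p0 := pi_gt0 R; move=> /IpiP/andP[x1 x2] /IpiP/andP[y1 y2].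
have -> : (Green x y + Green (- x) y) / 2 = (pi - Num.max `|x| `|y|) / 2.
  rewrite /Green.
  (* The average of |x - y| and |x + y| is the larger of |x| and |y|. *)
  have -> : Num.max `|x| `|y| = (`|x - y| + `|- x - y|) / 2.
    have [x0|x0] := leP 0 x; have [y0|y0] := leP 0 y;
    have [xy|xy] := leP 0 (x - y); have [xy'|xy'] := leP 0 (- x - y);
    rewrite ?(ger0_norm x0) ?(ltr0_norm x0) ?(ger0_norm y0) ?(ltr0_norm y0)
      ?(ger0_norm xy) ?(ltr0_norm xy) ?(ger0_norm xy') ?(ltr0_norm xy');
    rewrite /Num.max; case: ifP => ?; lra.
  by field; lra.
rewrite /Green_sym max_l// divr_ge0// subr_ge0 ge_max !ler_norml x1 x2 y1.
exact: y2.
Qed.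

(** On the interval this is [Green] itself; the truncation makes the kernel nonnegative everywhere,
    so that Tonelli and the layer cake apply on [setT]. *)
Definition Green_pos x y : R := Num.max (Green x y) 0.

Lemma measurable_Green_pos :
  measurable_fun setT (fun p : R * R => Green_pos p.1 p.2).
Proof.
apply: measurable_maxr => //; apply: measurable_funD => //.
apply: measurable_funB.
  apply: measurable_funM => //; apply: measurable_funN.
  exact: measurable_funM.
apply: measurable_funM => //; apply: measurableT_comp => //.
exact: measurable_funB.
Qed.

Lemma measurable_Green_posr x : measurable_fun setT (Green_pos x).
Proof. exact: measurableT_comp measurable_Green_pos (measurable_pair1 x). Qed.

Lemma measurable_Green_sym :
  measurable_fun setT (fun p : R * R => Green_sym p.1 p.2).
Proof.
apply: measurable_maxr => //; apply: measurable_funM => //.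
apply: measurable_funB => //.
by apply: measurable_maxr; apply: measurableT_comp.
Qed.

Lemma measurable_Green_symr x : measurable_fun setT (Green_sym x).
Proof. exact: measurableT_comp measurable_Green_sym (measurable_pair1 x). Qed.

Lemma Green_pos_ge0 x y : 0 <= Green_pos x y.
Proof. by rewrite le_max lexx orbT. Qed.

Lemma Green_sym_ge0 x y : 0 <= Green_sym x y.
Proof. by rewrite le_max lexx orbT. Qed.

Lemma Green_sym_le x x' y : `|x| <= `|x'| -> Green_sym x' y <= Green_sym x y.
Proof.
move=> xx; rewrite /Green_sym ge_max !le_max lexx orbT andbT; apply/orP; left.
rewrite ler_pM2r// lerB// ge_max !le_max xx lexx orbT; done.
Qed.

End green.

(** * Potentials of nonnegative densities *)

Section potential.
Context {R : realType}.
Local Notation lam := (@lebesgue_measure R).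
Local Notation Ipi := (@Ipi R).
Local Notation Green := (@Green R).
Implicit Types (f g h F H : R -> R) (x y : R).

(** No normalisation is meant: the total mass is only finite. Vanishing outside the interval lets
    all integrals run over the whole line. *)
Definition density F := [/\ measurable_fun setT F, (forall x, 0 <= F x),
  (forall x, ~ Ipi x -> F x = 0) & (\int[lam]_x (F x)%:E < +oo)%E].

Lemma ge0_integral_opp (g : R -> \bar R) : measurable_fun setT g ->
  (forall x, 0 <= g x)%E -> (\int[lam]_x g (- x)%R = \int[lam]_x g x)%E.
Proof.
move=> mg g0.
transitivity (\int[lam]_(x in (-%R : R -> measurableTypeR R) @^-1` setT) (g \o -%R) x)%E.
  by rewrite preimage_setT.
rewrite -ge0_integral_pushforward//=.
by apply: eq_measure_integral => A mA _; exact: lebesgue_measureN.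
Qed.

Lemma integral_Ipi (g : R -> R) :
  (forall x, ~ Ipi x -> g x = 0) ->
  (\int[lam]_(x in Ipi) (g x)%:E = \int[lam]_x (g x)%:E)%E.
Proof.
move=> g0; rewrite integral_mkcond; apply: eq_integral => x _.
by rewrite patchE; case: ifPn => // /negP xD; rewrite g0// => /mem_set.
Qed.

Section density.
Variable F : R -> R.
Hypothesis dF : density F.
Let mF : measurable_fun setT F. Proof. by case: dF. Qed.
Let F_ge0 x : 0 <= F x. Proof. by case: dF. Qed.
Let F_out x : ~ Ipi x -> F x = 0. Proof. by case: dF => ? ? + ?; apply. Qed.
Let F_fin : (\int[lam]_x (F x)%:E < +oo)%E. Proof. by case: dF. Qed.

Let mGF x : measurable_fun setT (fun y => (Green_pos x y * F y)%:E).
Proof.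
apply/measurable_EFinP => /=; apply: measurable_funM => //.
exact: measurable_Green_posr.
Qed.

Lemma integral_Green_pos_le x : Ipi x ->
  (\int[lam]_y (Green_pos x y * F y)%:E <= pi%:E * \int[lam]_y (F y)%:E)%E.
Proof.
move=> Dx; rewrite -ge0_integralZl//=.
- apply: ge0_le_integral => //=.
  + by move=> y _; rewrite lee_fin mulr_ge0// Green_pos_ge0.
  + exact: mGF.
  + by apply/measurable_EFinP => /=; exact: measurable_funM.
  + move=> y _; rewrite lee_fin.
    have [Dy|Dy] := pselect (Ipi y); last by rewrite F_out// !mulr0.
    by rewrite ler_wpM2r// /Green_pos ge_max Green_le_pi// pi_ge0.
- exact/measurable_EFinP.
- by move=> y _; rewrite lee_fin.
- by rewrite lee_fin pi_ge0.
Qed.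

(** The bound [Green <= pi] makes the integral finite, so the [fine] hidden in [ug] loses nothing
    and potentials can be handled as integrals of nonnegative functions. *)
Lemma EFin_ug x : Ipi x ->
  (ug F x)%:E = (\int[lam]_y (Green_pos x y * F y)%:E)%E.
Proof.
move=> Dx.
have E : (\int[lam]_(y in Ipi) (Green x y * F y)%:E =
          \int[lam]_y (Green_pos x y * F y)%:E)%E.
  rewrite -[RHS]integral_Ipi; last by move=> y Dy; rewrite F_out// mulr0.
  by apply: eq_integral => y /set_mem Dy; rewrite /Green_pos max_l// Green_ge0.
rewrite /ug /Rintegral E fineK// ge0_fin_numE; last first.
  by apply: integral_ge0 => y _; rewrite lee_fin mulr_ge0// Green_pos_ge0.
apply: le_lt_trans (integral_Green_pos_le Dx) _.
rewrite lte_mul_pinfty// ?lee_fin ?pi_ge0//.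
Qed.

Lemma ug_ge0 x : Ipi x -> 0 <= ug F x.
Proof.
move=> Dx; rewrite -lee_fin EFin_ug//; apply: integral_ge0 => y _.
by rewrite lee_fin mulr_ge0// Green_pos_ge0.
Qed.

Lemma ug_le : exists M : R, forall x, Ipi x -> ug F x <= M.
Proof.
have [M ME] : exists M : R, (\int[lam]_x (F x)%:E = M%:E)%E.
  exists (fine (\int[lam]_x (F x)%:E)%E); rewrite fineK// ge0_fin_numE//.
  by apply: integral_ge0 => y _; rewrite lee_fin.
exists (pi * M) => x Dx; rewrite -lee_fin EFin_ug//.
by apply: le_trans (integral_Green_pos_le Dx) _; rewrite ME EFinM.
Qed.

Lemma ug_boundary x : `|x| = pi -> Ipi x -> ug F x = 0.
Proof.
move=> xpi Dx; apply: EFin_inj; rewrite EFin_ug//; apply: integral0_eq => y _.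
have [Dy|Dy] := pselect (Ipi y); last by rewrite F_out// mulr0.
by rewrite /Green_pos Green_boundary// maxxx mul0r.
Qed.

Lemma measurable_ug : measurable_fun Ipi (ug F).
Proof.
apply: (@eq_measurable_fun _ _ _ _ _
  (fun x => fine (\int[lam]_y (Green_pos x y * F y)%:E)%E)).
  by move=> x /set_mem Dx; rewrite -EFin_ug.
apply: measurable_funTS; apply: measurableT_comp => //.
apply: (@measurable_fun_fubini_tonelli_F _ _ _ _ _ lam
  (fun p => (Green_pos p.1 p.2 * F p.2)%:E)).
  apply/measurable_EFinP => /=; apply: measurable_funM => //.
    exact: measurable_Green_pos.
  exact: measurableT_comp.
by move=> p; rewrite lee_fin mulr_ge0// Green_pos_ge0.
Qed.

Lemma IpiN x : Ipi x -> Ipi (- x).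
Proof. by move=> /IpiP xpi; apply/IpiP; lra. Qed.

(** The reflection y -> -y shows that an even density has the same integral against the kernels at
    [x] and at [- x]; the average of the two kernels is [Green_sym]. *)
Lemma EFin_ug_even x : (forall y, F (- y) = F y) -> Ipi x ->
  (ug F x)%:E = (\int[lam]_y (Green_sym x y * F y)%:E)%E.
Proof.
move=> Feven Dx.
have Gge0 z y : (0 <= (Green_pos z y * F y)%:E)%E.
  by rewrite lee_fin mulr_ge0// Green_pos_ge0.
have refl : (\int[lam]_y (Green_pos (- x) y * F y)%:E = (ug F x)%:E)%E.
  rewrite EFin_ug// -[LHS]ge0_integral_opp//.
  apply: eq_integral => y _; rewrite Feven; congr ((_ * _)%:E).
  by rewrite /Green_pos /Green mulrNN -opprD normrN.
transitivity ((2^-1 : R)%:E * ((ug F x)%:E + (ug F x)%:E))%E.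
  by rewrite -EFinD -EFinM; congr EFin; lra.
rewrite -{2}refl EFin_ug// -ge0_integralD//; [|exact: mGF|exact: mGF].
rewrite -ge0_integralZl_EFin//; last 2 first.
- by move=> y _; exact: adde_ge0.
- by apply: emeasurable_funD; exact: mGF.
apply: eq_integral => y _; rewrite -EFinD -EFinM; congr EFin.
have [Dy|Dy] := pselect (Ipi y); last by rewrite F_out// !mulr0 addr0 mulr0.
rewrite Green_symE// /Green_pos !max_l ?Green_ge0//; last exact: IpiN.
by field.
Qed.

End density.
End potential.

(** * Pointwise comparison of the potentials *)

Section comparison.
Context {R : realType}.
Local Notation lam := (@lebesgue_measure R).
Local Notation Ipi := (@Ipi R).
Implicit Types (f g h F H p q : R -> R) (a b x y : R).

Lemma lebesgue_measure_Ipi : lam Ipi = (2 * pi)%:E.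
Proof.
have p0 := pi_gt0 R; rewrite /Defs.Ipi lebesgue_measure_itv/= lte_fin.
rewrite ifT; last lra.
by rewrite -EFinD; congr EFin; lra.
Qed.

Lemma density_support_fin F : density F -> (lam [set x | 0 < F x]%R < +oo)%E.
Proof.
move=> [mF F0 Fout _]; apply: (@le_lt_trans _ _ (lam Ipi)).
  apply: le_lebesgue_measure; [exact: measurable_superlevel|exact: measurable_Ipi|].
  by move=> x /= Fx; apply: contrapT => /Fout Fx0; rewrite Fx0 ltxx in Fx.
by rewrite lebesgue_measure_Ipi ltry.
Qed.

Lemma superlevel_fin_num F (t : R) : density F -> 0 <= t ->
  lam [set x | t < F x] \is a fin_num.
Proof.
move=> dF t0; rewrite ge0_fin_numE//; apply: le_lt_trans (density_support_fin dF).
have [mF _ _ _] := dF; apply: le_lebesgue_measure; try exact: measurable_superlevel.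
by move=> x /=; exact: le_lt_trans.
Qed.

(* The kernel is a trapezoid, flat between a and b exactly because of the choice
   of the weight w; its height is at most (pi - r) / 2 and its two slopes w and
   1 - w have product at most 1/4. *)
Lemma trapezoid_le (a b c d : R) (r := (b - a) / 2)
    (w := (pi - b) / (2 * pi - (b - a)))
    (K := fun y => w * Green_pos a y + (1 - w) * Green_pos b y) :
  - pi < a -> a <= b -> b < pi -> - pi <= c -> c <= d -> d <= pi ->
  Num.min (K c) (K d) <= (pi - Num.max r ((d - c) / 2)) / 2.
Proof.
move=> a1 ab b1 c1 cd d1; have p0 := pi_gt0 R.
have m0 : 0 < 2 * pi - (b - a) by lra.
have w0 : 0 <= w by rewrite divr_ge0; lra.
have wE : 1 - w = (pi + a) / (2 * pi - (b - a)) by rewrite /w; field; lra.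
have w1 : 0 <= 1 - w by rewrite wE divr_ge0; lra.
have KE y : Ipi y -> K y = w * Green a y + (1 - w) * Green b y.
  by move=> Dy; rewrite /K /Green_pos !max_l// Green_ge0//; apply/IpiP; lra.
have Dc : Ipi c by apply/IpiP; lra.
have Dd : Ipi d by apply/IpiP; lra.
(* Left branches at both points: the slope is [w] because [w * (pi - a) + (1 - w) * (pi - b) = 2 *
   pi * w]. *)
have Kleft y : Ipi y -> K y <= w * (pi + y).
  move=> Dy; rewrite KE//.
  apply: (le_trans (lerD (ler_wpM2l w0 (Green_le_left a y))
                         (ler_wpM2l w1 (Green_le_left b y)))).
  by rewrite wE /w le_eqVlt; apply/orP; left; apply/eqP; field; lra.
have Kright y : Ipi y -> K y <= (1 - w) * (pi - y).
  move=> Dy; rewrite KE//.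
  apply: (le_trans (lerD (ler_wpM2l w0 (Green_le_right a y))
                         (ler_wpM2l w1 (Green_le_right b y)))).
  by rewrite wE /w le_eqVlt; apply/orP; left; apply/eqP; field; lra.
(* Right branch at [a], left branch at [b]: [y] cancels because
   [w * (pi + a) = (1 - w) * (pi - b)]. *)
have Kheight y : Ipi y -> K y <= (pi + a) * (pi - b) / (2 * pi - (b - a)).
  move=> Dy; rewrite KE//.
  apply: (le_trans (lerD (ler_wpM2l w0 (Green_le_right a y))
                         (ler_wpM2l w1 (Green_le_left b y)))).
  by rewrite wE /w le_eqVlt; apply/orP; left; apply/eqP; field; lra.
rewrite /Num.max; case: ifP => _.
  rewrite leNgt lt_min; apply/negP => /andP[Kc Kd].
  have {Kc}Kc := lt_le_trans Kc (Kleft c Dc).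
  have {Kd}Kd := lt_le_trans Kd (Kright d Dd).
  clearbody w; clear - c1 cd d1 w0 w1 Kc Kd p0.
  set P := pi + c in Kc; set Q := pi - d in Kd.
  have E : (pi - (d - c) / 2) / 2 = (P + Q) / 4 by rewrite /P /Q; lra.
  rewrite E in Kc Kd.
  have P0 : 0 <= P by rewrite /P; lra.
  have Q0 : 0 <= Q by rewrite /Q; lra.
  have [w00|w00] := eqVneq w 0; first by rewrite w00 mul0r in Kc; lra.
  have [w11|w11] := eqVneq (1 - w) 0; first by rewrite w11 mul0r in Kd; lra.
  have wgt0 : 0 < w by rewrite lt_neqAle eq_sym w00.
  have w1gt0 : 0 < 1 - w by rewrite lt_neqAle eq_sym w11.
  (* Weighting the two assumed bounds by [1 - w] and [w] and adding them gives (P + Q)/4 < w(1 -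
     w)(P + Q), against w(1 - w) <= 1/4. *)
  have H1 : (1 - w) * ((P + Q) / 4) < (1 - w) * (w * P) by rewrite ltr_pM2l.
  have H2 : w * ((P + Q) / 4) < w * ((1 - w) * Q) by rewrite ltr_pM2l.
  have H3 : (P + Q) * (w * (1 - w)) <= (P + Q) * 4^-1.
    rewrite ler_wpM2l//; first lra.
    have := sqr_ge0 (w - 2^-1); rewrite expr2; lra.
  lra.
apply: (@le_trans _ _ (K c)); first by rewrite ge_min lexx.
(* With X = pi + a and Y = pi - b the claim is XY/(X + Y) <= (X + Y)/4, where X - Y = a + b. *)
apply: (le_trans (Kheight c Dc)); rewrite ler_pdivrMr// /r.
have := sqr_ge0 (a + b); rewrite expr2; lra.
Qed.

Section densities.
Variables F H : R -> R.
Hypotheses (dF : density F) (dH : density H).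
Hypothesis Heven : forall y, H (- y) = H y.
Hypothesis FH : forall t x, 0 <= t -> x != 0 ->
  ((2 * `|x|)%:E < lam [set y | t < F y]%R)%E -> t < H x.

(* Talenti's comparison, in terms of superlevel sets. *)
Lemma ug_min_le a b x : Ipi a -> Ipi b -> a <= b -> `|x| <= (b - a) / 2 ->
  Num.min (ug F a) (ug F b) <= ug H x.
Proof.
have p0 := pi_gt0 R.
move=> Da Db ab xab; have [/IpiP a1 /IpiP b1] := (Da, Db).
have Dx : Ipi x by apply/IpiP; rewrite -ler_norml; lra.
(* At an endpoint the potential vanishes and the claim is nonnegativity; excluding this case also
   keeps the denominator of [w] positive. *)
have [aE|aE] := eqVneq a (- pi).
  by rewrite ge_min ug_boundary ?ug_ge0// aE normrN ger0_norm; lra.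
have [bE|bE] := eqVneq b pi.
  by rewrite ge_min orbC ug_boundary ?ug_ge0// bE ger0_norm; lra.
have a2 : - pi < a by rewrite lt_neqAle eq_sym aE; lra.
have b2 : b < pi by rewrite lt_neqAle bE; lra.
pose r := (b - a) / 2.
pose w := (pi - b) / (2 * pi - (b - a)).
have w0 : 0 <= w by rewrite divr_ge0; lra.
have w1 : 0 <= 1 - w.
  rewrite (_ : 1 - w = (pi + a) / (2 * pi - (b - a))) ?divr_ge0; try lra.
  by rewrite /w; field; lra.
apply: (@le_trans _ _ (w * ug F a + (1 - w) * ug F b)).
  set s := Num.min _ _.
  have sa : s <= ug F a by rewrite ge_min lexx.
  have sb : s <= ug F b by rewrite ge_min lexx orbT.
  rewrite (_ : s = w * s + (1 - w) * s); last by ring.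
  by rewrite lerD// ler_wpM2l.
have Dr : Ipi r by apply/IpiP; rewrite /r; lra.
pose K y := w * Green_pos a y + (1 - w) * Green_pos b y.
have [[mF F0 Fout _] [mH H0 _ _]] := (dF, dH).
have K0 y : 0 <= K y by rewrite addr_ge0// mulr_ge0// Green_pos_ge0.
have mK : measurable_fun setT K.
  by apply: measurable_funD; apply: measurable_funM => //; exact: measurable_Green_posr.
have mGF z : measurable_fun setT (fun y => (Green_pos z y * F y)%:E).
  apply/measurable_EFinP => /=; apply: measurable_funM => //.
  exact: measurable_Green_posr.
have GF0 z y : (0 <= (Green_pos z y * F y)%:E)%E.
  by rewrite lee_fin mulr_ge0// Green_pos_ge0.
have mGH z : measurable_fun setT (fun y => (Green_sym z y * H y)%:E).
  apply/measurable_EFinP => /=; apply: measurable_funM => //.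
  exact: measurable_Green_symr.
rewrite -lee_fin EFinD !EFinM (EFin_ug_even dH)// !EFin_ug//.
have Z z (c : R) : 0 <= c -> (c%:E * \int[lam]_y (Green_pos z y * F y)%:E =
    \int[lam]_y (c%:E * (Green_pos z y * F y)%:E))%E.
  by move=> c0; rewrite ge0_integralZl_EFin//; exact: mGF.
rewrite !Z// -ge0_integralD//; last 4 first.
- by move=> y _; rewrite mule_ge0.
- by apply: measurable_funeM; exact: mGF.
- by move=> y _; rewrite mule_ge0.
- by apply: measurable_funeM; exact: mGF.
under eq_integral => y _.
  rewrite -!EFinM -EFinD !mulrA -mulrDl -/(K y).
  over.
(* Rearrangement gives the bound at the extreme radius [r]; monotonicity of [Green_sym] in |x|
   carries it to every [x] with |x| <= r. *)
apply: (@le_trans _ _ (\int[lam]_y (Green_sym r y * H y)%:E)%E).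
  apply: riesz_rearrangement => //.
  - exact: measurable_Green_symr.
  - by move=> y; exact: Green_sym_ge0.
  - exact: density_support_fin.
  move=> c d y Fc Fd cd ycd.
  have /IpiP/andP[c1 _] : Ipi c by apply: contrapT => /Fout Fx0; rewrite Fx0 ltxx in Fc.
  have /IpiP/andP[_ d1] : Ipi d by apply: contrapT => /Fout Fx0; rewrite Fx0 ltxx in Fd.
  apply: (le_trans (trapezoid_le a2 ab b2 c1 cd d1)).
  rewrite /Green_sym le_max; apply/orP; left; rewrite ler_pM2r// lerB// -/r.
  have r0 : 0 <= r by rewrite /r; lra.
  by rewrite (ger0_norm r0) ge_max !le_max lexx ycd orbT.
apply: ge0_le_integral => //.
- by move=> y _; rewrite lee_fin mulr_ge0// Green_sym_ge0.
- exact: mGH.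
- exact: mGH.
move=> y _; rewrite lee_fin ler_wpM2r// Green_sym_le//.
by rewrite (le_trans xab)// ler_norm.
Qed.

End densities.
End comparison.

(** * Star functions and integrals of functions of the potentials *)

Section convex_means.
Context {R : realType}.
Local Notation lam := (@lebesgue_measure R).
Local Notation Ipi := (@Ipi R).
Implicit Types (f g h F H p q phi : R -> R) (a b x y : R).

(** The second use of the rearrangement inequality: the indicators of [E] and of the centred
    interval of the same length take the place of the densities. Arbitrary [E] serves the star
    function, [E = Ipi] the integral means. *)
Lemma integral_le_centered (E : set R) (t : R) p q :
  measurable E -> E `<=` Ipi -> lam E = t%:E ->
  measurable_fun Ipi p -> measurable_fun Ipi q ->
  (forall x, Ipi x -> 0 <= p x) -> (forall x, Ipi x -> 0 <= q x) ->
  (forall a b x, Ipi a -> Ipi b -> a <= b -> `|x| <= (b - a) / 2 ->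
    Num.min (p a) (p b) <= q x) ->
  (\int[lam]_(x in E) (p x)%:E <=
   \int[lam]_(x in `[(- (t / 2))%R, (t / 2)%R]) (q x)%:E)%E.
Proof.
move=> mE EI Et mp mq p0 q0 pq.
have p0' := pi_gt0 R.
have t0 : 0 <= t by rewrite -lee_fin -Et.
have tpi : t <= 2 * pi.
  by rewrite -lee_fin -Et -lebesgue_measure_Ipi;
    apply: le_lebesgue_measure => //; exact: measurable_Ipi.
pose J := `[- (t / 2), t / 2]%classic : set R.
have mJ : measurable J by exact: measurable_itv.
have JI : J `<=` Ipi by move=> x; rewrite /J /= in_itv/= => xt; apply/IpiP; lra.
have restr (A : set R) g : A `<=` Ipi -> (\int[lam]_(x in A) (g x)%:E =
    \int[lam]_x ((g \_ Ipi) x * \1_A x)%:E)%E.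
  move=> AI; rewrite integral_mkcond; apply: eq_integral => x _.
  rewrite !patchE indicE; case: ifPn => xA; last by rewrite mulr0.
  by rewrite mem_set ?mulr1//; exact/AI/set_mem.
have mrestr g : measurable_fun Ipi g -> measurable_fun setT (g \_ Ipi).
  by move=> mg; apply/(measurable_restrictT g measurable_Ipi).
have ge0restr g x : (forall x, Ipi x -> 0 <= g x) -> 0 <= (g \_ Ipi) x.
  by move=> g0; rewrite patchE; case: ifPn => // /set_mem; exact: g0.
rewrite (restr E)// (restr J)//; apply: riesz_rearrangement => //.
- exact: mrestr.
- exact: mrestr.
- by move=> x; exact: ge0restr.
- by move=> x; exact: ge0restr.
- apply: (@le_lt_trans _ _ (lam E)); last by rewrite Et ltry.
  apply: le_lebesgue_measure => //.
    exact: (@measurable_superlevel _ (\1_E : R -> R)).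
  by move=> x /=; rewrite indicE; case: (boolP (x \in E)) => [/set_mem//|_]; rewrite ltxx.
- move=> a b x; rewrite !indicE.
  case: (boolP (a \in E)) => [/set_mem/EI Da _|_]; last by rewrite ltxx.
  case: (boolP (b \in E)) => [/set_mem/EI Db _|_]; last by rewrite ltxx.
  move=> ab xab; rewrite !patchE !mem_set//; first exact: pq.
  move: Da Db => /IpiP Da /IpiP Db; apply/IpiP; rewrite -ler_norml; lra.
- move=> s x s0 x0; have [s1|s1] := ltP s 1; last first.
    rewrite (_ : [set _ | _] = set0) ?measure0.
      by rewrite lte_fin ltNge mulr_ge0.
    by rewrite -subset0 => y /=; rewrite indicE; case: (_ \in _) => /=; lra.
  rewrite (_ : [set _ | _] = E); last first.
    apply/seteqP; split => y /=; rewrite indicE; last by move=> Ey; rewrite mem_set.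
    by case: (boolP (y \in E)) => [/set_mem//|_] /=; lra.
  rewrite Et lte_fin => xt; have xJ : J x by rewrite /J /= in_itv/= -ler_norml; lra.
  by rewrite indicE mem_set.
Qed.

Section densities.
Variables F H : R -> R.
Hypotheses (dF : density F) (dH : density H).
Hypothesis Heven : forall y, H (- y) = H y.
Hypothesis FH : forall t x, 0 <= t -> x != 0 ->
  ((2 * `|x|)%:E < lam [set y | t < F y]%R)%E -> t < H x.

Lemma star_ug_le (t : R) : 0 <= t -> t <= 2 * pi ->
  (star (ug F) t <= star (ug H) t)%E.
Proof.
move=> t0 tpi; apply: ub_ereal_sup => _ [E [mE [EI Et]] <-].
apply: (le_trans (integral_le_centered mE EI Et (measurable_ug dF) (measurable_ug dH)
  (ug_ge0 dF) (ug_ge0 dH) (ug_min_le dF dH Heven FH))).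
apply: ereal_sup_ubound; exists `[- (t / 2), t / 2]%classic => //.
split; first exact: measurable_itv; split.
  by move=> x /=; rewrite in_itv/= => xt; apply/IpiP; lra.
rewrite lebesgue_measure_itv/= lte_fin; case: ltP => tt.
  by rewrite -EFinD; congr EFin; lra.
by congr EFin; lra.
Qed.
End densities.

(** The potential takes values in some [0, M], so the composition stays between [phi 0] and [phi M]
    on a set of finite measure. *)
Lemma integrable_comp_ug F phi : density F -> {homo phi : x y / x <= y} ->
  lam.-integrable Ipi (fun x => (phi (ug F x))%:E).
Proof.
move=> dF phi_homo; have [M uM] := ug_le dF.
have mphi : measurable_fun Ipi (phi \o ug F).
  by apply: measurableT_comp; [exact: nondecreasing_measurable|exact: measurable_ug].
apply: measurable_bounded_integrable => //.
- exact: measurable_Ipi.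
- by apply: (@le_lt_trans _ _ (lam Ipi)) => //; rewrite lebesgue_measure_Ipi ltry.
exists (Num.max `|phi 0| `|phi M|); split; first exact: num_real.
move=> r rM x Dx /=; apply: le_trans (ltW rM).
have := phi_homo _ _ (ug_ge0 dF Dx); have := phi_homo _ _ (uM x Dx).
move=> h1 h2; rewrite le_max; have [p0|p0] := leP 0 (phi (ug F x)).
  by apply/orP; right; rewrite ger0_norm// (le_trans h1)// ler_norm.
apply/orP; left; rewrite ltr0_norm// ler0_norm ?lerN2//.
exact/ltW/(le_lt_trans h2).
Qed.

Section densities.
Variables F H : R -> R.
Hypotheses (dF : density F) (dH : density H).
Hypothesis Heven : forall y, H (- y) = H y.
Hypothesis FH : forall t x, 0 <= t -> x != 0 ->
  ((2 * `|x|)%:E < lam [set y | t < F y]%R)%E -> t < H x.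

Lemma integral_comp_ug_le phi : {homo phi : x y / x <= y} ->
  (\int[lam]_(x in Ipi) (phi (ug F x))%:E <=
   \int[lam]_(x in Ipi) (phi (ug H x))%:E)%E.
Proof.
move=> phi_homo; have p0 := pi_gt0 R.
(* Potentials are nonnegative, so [psi] of them is too; the constant removed contributes the same
   finite amount to both sides. *)
pose psi x := phi x - phi 0.
have psi_homo : {homo psi : x y / x <= y} by move=> x y xy; rewrite lerB// phi_homo.
have split G : density G -> (\int[lam]_(x in Ipi) (phi (ug G x))%:E =
    \int[lam]_(x in Ipi) (psi (ug G x))%:E + (phi 0%R)%:E * (2 * pi)%:E)%E.
  move=> dG; rewrite -lebesgue_measure_Ipi -integral_cst; last exact: measurable_Ipi.
  rewrite -integralD; last 3 first.
  - exact: measurable_Ipi.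
  - exact: integrable_comp_ug.
  - by apply: (@integrable_comp_ug G (fun=> phi 0)) => //.
  by apply: eq_integral => x _; rewrite -EFinD subrK.
rewrite !split// leeD2r//.
have IE : Ipi = `[(- (2 * pi / 2))%R, (2 * pi / 2)%R]%classic.
  by rewrite (_ : 2 * pi / 2 = pi :> R)//; field.
rewrite [in leRHS]IE; apply: integral_le_centered => //.
- exact: measurable_Ipi.
- exact: lebesgue_measure_Ipi.
- apply: measurableT_comp; first exact: nondecreasing_measurable.
  exact: measurable_ug.
- apply: measurableT_comp; first exact: nondecreasing_measurable.
  exact: measurable_ug.
- by move=> x Dx; rewrite subr_ge0 phi_homo// ug_ge0.
- by move=> x Dx; rewrite subr_ge0 phi_homo// ug_ge0.
move=> a b x Da Db ab xab; have := ug_min_le dF dH Heven FH Da Db ab xab.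
rewrite !ge_min => /orP[|] le_u; apply/orP; [left|right]; exact: psi_homo.
Qed.

(* A strictly increasing convex function has slope at least
   phi 0 - phi (-1) > 0 on the nonnegative reals: what remains after
   subtracting this linear part is still nondecreasing there. *)
Lemma integral_ug_eq phi : convex_fun phi -> {homo phi : x y / x < y} ->
  (\int[lam]_(x in Ipi) (phi (ug F x))%:E =
   \int[lam]_(x in Ipi) (phi (ug H x))%:E)%E ->
  (\int[lam]_(x in Ipi) (ug F x)%:E = \int[lam]_(x in Ipi) (ug H x)%:E)%E.
Proof.
move=> phi_cvx phi_homo.
pose c := phi 0 - phi (-1).
have c0 : 0 < c by rewrite subr_gt0 phi_homo//; lra.
(* Cutting at 0 makes [psi] nondecreasing on the whole line without changing it on the values of the
   potentials. *)
pose psi x := phi (Num.max x 0) - c * Num.max x 0.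
have psi_homo : {homo psi : x y / x <= y}.
  move=> x y xy; rewrite /psi.
  set x' := Num.max x 0; set y' := Num.max y 0.
  have x'0 : 0 <= x' by rewrite le_max lexx orbT.
  have : x' <= y' by rewrite ge_max !le_max xy lexx orbT.
  rewrite le_eqVlt => /predU1P[->//|xy'].
  clearbody x' y'; clear x y xy.
  have n0 : 0 < y' + 1 by lra.
  (* chord inequality on [-1, y'], cleared of denominators *)
  have chord z : -1 <= z -> z <= y' ->
      (y' + 1) * phi z <= (y' - z) * phi (-1) + (1 + z) * phi y'.
    move=> z1 z2; pose l := (y' - z) / (y' + 1).
    have l0 : 0 <= l by rewrite divr_ge0; lra.
    have l1 : l <= 1 by rewrite ler_pdivrMr; lra.
    have := phi_cvx (-1) y' l l0 l1.
    have -> : l * -1 + (1 - l) * y' = z by rewrite /l; field; lra.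
    move=> /(ler_wpM2l (ltW n0)) /le_trans; apply.
    by rewrite le_eqVlt; apply/orP; left; apply/eqP; rewrite /l; field; lra.
  (* The chord at x' bounds the slope of phi on [x', y'] below by its slope on [-1, y']; the chord
     at 0 bounds that one below by [c]. *)
  have h1 : (y' + 1) * phi x' <= (y' - x') * phi (-1) + (1 + x') * phi y'.
    by apply: chord; lra.
  have h0 : (y' + 1) * phi 0 <= (y' - 0) * phi (-1) + (1 + 0) * phi y'.
    by apply: chord; lra.
  have h0' : (y' + 1) * c <= phi y' - phi (-1) by rewrite /c; lra.
  have d0 : 0 <= y' - x' by lra.
  have h2 := ler_wpM2l d0 h0'.
  by rewrite -(ler_pM2l n0); lra.
have idh : {homo (fun x : R => x) : x y / x <= y} by [].
have split G : density G -> (\int[lam]_(x in Ipi) (phi (ug G x))%:E =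
    \int[lam]_(x in Ipi) (psi (ug G x))%:E + c%:E * \int[lam]_(x in Ipi) (ug G x)%:E)%E.
  move=> dG; rewrite -integralZl; last 2 first.
  - exact: measurable_Ipi.
  - exact: (integrable_comp_ug dG idh).
  rewrite -integralD; last 3 first.
  - exact: measurable_Ipi.
  - exact: integrable_comp_ug.
  - by apply: integrableZl; [exact: measurable_Ipi|exact: (integrable_comp_ug dG idh)].
  apply: eq_integral => x /set_mem Dx; rewrite -EFinM -EFinD /psi.
  by rewrite max_l ?ug_ge0// subrK.
have fin G g : density G -> {homo g : x y / x <= y} ->
    exists r, (\int[lam]_(x in Ipi) (g (ug G x))%:E)%E = r%:E.
  move=> dG gh; exists (fine (\int[lam]_(x in Ipi) (g (ug G x))%:E)%E).
  rewrite fineK//; apply: integrable_fin_num; [exact: measurable_Ipi|].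
  exact: integrable_comp_ug.
(* Both summands, the mean of [psi] and [c] times the mean of the potential, are ordered the same
   way; equal finite sums force equality in each. *)
have := integral_comp_ug_le psi_homo; have := integral_comp_ug_le idh.
move=> le34 le12; rewrite !split//; move: le34 le12.
have [r1 ->] := fin F psi dF psi_homo; have [r2 ->] := fin H psi dH psi_homo.
have [r3 ->] := fin F id dF idh; have [r4 ->] := fin H id dH idh.
rewrite -!EFinM -!EFinD !lee_fin => le34 le12 [e].
congr EFin; apply/eqP; rewrite eq_le le34/=.
by rewrite -(ler_pM2l c0); lra.
Qed.

End densities.
End convex_means.

(** * The torsion function *)

Section equality.
Context {R : realType}.
Local Notation lam := (@lebesgue_measure R).
Local Notation Ipi := (@Ipi R).
Implicit Types (f g h F H p q phi : R -> R) (a b x y : R).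

Definition one_Ipi : R -> R := \1_Ipi.

Lemma density_one_Ipi : density one_Ipi.
Proof.
split.
- exact: measurable_indic measurable_Ipi.
- by move=> x; rewrite /one_Ipi indicE.
- by move=> x Dx; rewrite /one_Ipi indicE memNset.
- rewrite integral_indic//; last exact: measurable_Ipi.
  by rewrite setIT; apply: (@le_lt_trans _ _ (2 * pi)%:E);
    rewrite ?ltry// -lebesgue_measure_Ipi.
Qed.

Lemma one_IpiN x : one_Ipi (- x) = one_Ipi x.
Proof.
rewrite /one_Ipi !indicE; congr (_%:R); congr nat_of_bool.
by apply/idP/idP => /set_mem/IpiN => [|]; rewrite ?opprK => ?; exact/mem_set.
Qed.

(** No closed formula is needed. With [m] midway between |x| and |y|, the kernel at [x] exceeds the
    one at [y] by at least [e] on [-m, m], a set of positive measure, and is nowhere smaller. *)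
Lemma ug_one_lt x y : `|x| < `|y| -> Ipi y -> ug one_Ipi y < ug one_Ipi x.
Proof.
move=> xy Dy; have p0 := pi_gt0 R.
have ypi : `|y| <= pi by move/IpiP: Dy; rewrite ler_norml.
have Dx : Ipi x by apply/IpiP; rewrite -ler_norml; lra.
pose m := (`|x| + `|y|) / 2; pose e := (`|y| - m) / 2.
have x0 := normr_ge0 x.
have m0 : 0 < m by rewrite /m; lra.
have e0 : 0 < e by rewrite /e /m; lra.
pose J := `[- m, m]%classic : set R.
suff : ((ug one_Ipi y)%:E + e%:E * lam J <= (ug one_Ipi x)%:E)%E.
  have -> : lam J = (m - - m)%:E.
    by rewrite lebesgue_measure_itv/= lte_fin ifT ?EFinB//; lra.
  rewrite -EFinM -EFinD lee_fin.
  by apply: lt_le_trans; rewrite ltrDl mulr_gt0//; lra.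
have ev := one_IpiN; have dO := density_one_Ipi.
have mG z : measurable_fun setT (fun y => (Green_sym z y * one_Ipi y)%:E).
  apply/measurable_EFinP => /=; apply: measurable_funM => //.
    exact: measurable_Green_symr.
  by case: dO.
have G0 z w : (0 <= (Green_sym z w * one_Ipi w)%:E)%E.
  by rewrite lee_fin mulr_ge0 ?Green_sym_ge0// /one_Ipi indicE.
have mJ : measurable J by exact: measurable_itv.
have mJ1 : measurable_fun setT (fun z => (\1_J z : R)%:E).
  by apply/measurable_EFinP; exact: measurable_indic.
have J0 z : (0 <= e%:E * (\1_J z : R)%:E)%E.
  by rewrite -EFinM lee_fin mulr_ge0//; exact: ltW.
have -> : (e%:E * lam J = \int[lam]_z (e%:E * (\1_J z : R)%:E))%E.
  rewrite ge0_integralZl_EFin//.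
  - by rewrite integral_indic// setIT.
  - exact: ltW.
rewrite !(EFin_ug_even dO ev)// -ge0_integralD//; [|exact: mG|exact: measurable_funeM].
apply: ge0_le_integral => //.
- by move=> z _; exact: adde_ge0.
- by apply: emeasurable_funD; [exact: mG|exact: measurable_funeM].
- exact: mG.
move=> z _; rewrite -EFinM -EFinD lee_fin.
have Gxy := @Green_sym_le _ x y z (ltW xy).
rewrite [\1_J _]indicE; case: (boolP (z \in J)) => /= zJ; last first.
  by rewrite mulr0 addr0 ler_wpM2r// /one_Ipi indicE.
have zm : `|z| <= m by move: zJ; rewrite inE /J/= in_itv/= ler_norml.
have Dz : Ipi z by apply/IpiP; rewrite -ler_norml /m in zm *; lra.
rewrite /one_Ipi indicE mem_set//= !mulr1.
rewrite /Green_sym.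
have -> : Num.max `|y| `|z| = `|y| by rewrite max_l// (le_trans zm)// /m; lra.
rewrite max_l; last by rewrite divr_ge0//; lra.
rewrite le_max; apply/orP; left.
have : Num.max `|x| `|z| <= m by rewrite ge_max zm andbT /m; lra.
by rewrite /e; lra.
Qed.

Lemma ug_one_le x y : `|x| <= `|y| -> Ipi y -> ug one_Ipi y <= ug one_Ipi x.
Proof.
move=> xy Dy.
have Dx : Ipi x by apply/IpiP; move/IpiP: Dy; rewrite -!ler_norml; exact: le_trans.
rewrite -lee_fin !(EFin_ug_even density_one_Ipi one_IpiN)//.
have G0 z w : (0 <= (Green_sym z w * one_Ipi w)%:E)%E.
  by rewrite lee_fin mulr_ge0 ?Green_sym_ge0// /one_Ipi indicE.
have mG z : measurable_fun setT (fun y => (Green_sym z y * one_Ipi y)%:E).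
  apply/measurable_EFinP => /=; apply: measurable_funM => //.
    exact: measurable_Green_symr.
  by case: density_one_Ipi.
apply: ge0_le_integral => //; [exact: mG|exact: mG|move=> z _].
by rewrite lee_fin ler_wpM2r ?Green_sym_le.
Qed.

(* Solution of - u'' = 1 with zero boundary values. *)
Definition torsion : R -> R := ug one_Ipi \_ Ipi.

Lemma torsionE x : Ipi x -> torsion x = ug one_Ipi x.
Proof. by move=> Dx; rewrite /torsion patchE mem_set. Qed.

Lemma measurable_torsion : measurable_fun setT torsion.
Proof.
apply/(measurable_restrictT _ measurable_Ipi).
exact: measurable_ug density_one_Ipi.
Qed.

Lemma torsion_ge0 x : 0 <= torsion x.
Proof.
rewrite /torsion patchE; case: ifPn => // /set_mem Dx.
exact: (ug_ge0 density_one_Ipi Dx).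
Qed.

Lemma torsion_le : exists2 M, 0 <= M & forall x, torsion x <= M.
Proof.
have [M uM] := ug_le density_one_Ipi.
exists (Num.max M 0) => [|x]; first by rewrite le_max lexx orbT.
rewrite /torsion patchE le_max; case: ifPn => [/set_mem/uM ->//|_].
by apply/orP; right; exact: lexx.
Qed.

(** Tonelli and the symmetry of [Green]: the solution operator is self-adjoint, and the mean is a
    pairing with the constant 1. *)
Lemma integral_ug F : density F -> (\int[lam]_(x in Ipi) (ug F x)%:E =
  \int[lam]_y (torsion y * F y)%:E)%E.
Proof.
move=> dF; have [mF F0 Fout _] := dF.
have [mO O0 Oout _] := density_one_Ipi.
pose G (p : R * R) := (one_Ipi p.1 * Green_pos p.1 p.2 * F p.2)%:E.
have mG : measurable_fun setT G.
  apply/measurable_EFinP => /=; apply: measurable_funM; last exact: measurableT_comp.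
  by apply: measurable_funM; [exact: measurableT_comp|exact: measurable_Green_pos].
have G0 (z : R * R) : (0 <= G z)%E by rewrite lee_fin !mulr_ge0 ?Green_pos_ge0.
transitivity (\int[lam]_x \int[lam]_y G (x, y))%E.
  rewrite integral_mkcond; apply: eq_integral => x _.
  rewrite patchE; case: ifPn => [/set_mem Dx|/negP xD].
    rewrite (EFin_ug dF)//; apply: eq_integral => y _.
    by rewrite /G /one_Ipi /= indicE mem_set// mul1r.
  rewrite integral0_eq// => y _; rewrite /G /= Oout ?mul0r// => Dx; apply: xD.
  exact: mem_set.
rewrite fubini_tonelli//; apply: eq_integral => y _.
have [Dy|Dy] := pselect (Ipi y); last first.
  by rewrite Fout// mulr0 integral0_eq// => x _; rewrite /G/= Fout// mulr0.
rewrite torsionE// EFinM (EFin_ug density_one_Ipi)// muleC.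
rewrite -ge0_integralZl_EFin//.
- apply: eq_integral => x _; rewrite -EFinM /G/=; congr EFin.
  by rewrite /Green_pos GreenC; ring.
- by move=> x _; rewrite lee_fin mulr_ge0 ?Green_pos_ge0.
- apply/measurable_EFinP => /=; apply: measurable_funM => //.
  exact: measurable_Green_posr.
Qed.

Lemma integral_torsion_fin F : density F ->
  (\int[lam]_x (torsion x * F x)%:E < +oo)%E.
Proof.
move=> [mF F0 _ Ffin]; have [M M0 WM] := torsion_le.
apply: (@le_lt_trans _ _ (M%:E * \int[lam]_x (F x)%:E)%E); last first.
  by rewrite lte_mul_pinfty.
rewrite -ge0_integralZl_EFin//; last 2 first.
- by move=> x _; rewrite lee_fin.
- exact/measurable_EFinP.
apply: ge0_le_integral => //.
- by move=> x _; rewrite lee_fin mulr_ge0// torsion_ge0.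
- by apply/measurable_EFinP; apply: measurable_funM => //; exact: measurable_torsion.
- by apply: measurable_funeM; exact/measurable_EFinP.
- by move=> x _; rewrite -EFinM lee_fin ler_wpM2r.
Qed.

End equality.

(** * Rigidity when the means of the potentials agree *)

Section equality_case.
Context {R : realType}.
Local Notation lam := (@lebesgue_measure R).
Local Notation Ipi := (@Ipi R).
Implicit Types (F H : R -> R) (t x y : R).

Lemma lebesgue_ae_imp (P Q : R -> Prop) : (forall x, P x -> Q x) ->
  {ae lam, forall x, P x} -> {ae lam, forall x, Q x}.
Proof. by move=> PQ; apply: negligibleS => x /= nQx /PQ. Qed.

Lemma lebesgue_ae_and (P Q : R -> Prop) : {ae lam, forall x, P x} ->
  {ae lam, forall x, Q x} -> {ae lam, forall x, P x /\ Q x}.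
Proof.
move=> aP aQ; have : lam.-negligible (~` P `|` ~` Q) by exact: negligibleU.
by apply: negligibleS => x /= /not_andP.
Qed.

Lemma lebesgue_measure_negligible0 (A : set R) :
  measurable A -> lam.-negligible A -> lam A = 0%E.
Proof. by move=> mA [B [mB B0 AB]]; exact: subset_measure0 B0. Qed.

Lemma ge0_integral_eq0 (g : R -> \bar R) : measurable_fun setT g ->
  (forall x, 0 <= g x)%E -> (\int[lam]_x g x = 0)%E ->
  {ae lam, forall x, g x = 0%E}.
Proof.
move=> mg g0 Ig.
have := (ae_eq_integral_abs lam measurableT mg).1.
under eq_integral do rewrite gee0_abs//.
by move=> /(_ Ig); apply: lebesgue_ae_imp => x; apply.
Qed.

Lemma le_integral_eq (g h : R -> \bar R) : measurable_fun setT g ->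
  measurable_fun setT h -> (forall x, 0 <= g x)%E -> (forall x, g x <= h x)%E ->
  (forall x, h x \is a fin_num) ->
  (\int[lam]_x g x = \int[lam]_x h x)%E -> (\int[lam]_x h x < +oo)%E ->
  {ae lam, forall x, g x = h x}.
Proof.
move=> mg mh g0 gh hfin Igh Ih.
have h0 x : (0 <= h x)%E by exact: le_trans (gh x).
have gfin x : g x \is a fin_num.
  by rewrite ge0_fin_numE//; apply: le_lt_trans (gh x) _; rewrite -ge0_fin_numE.
have ih : lam.-integrable setT h.
  by apply/integrableP; split=> //; under eq_integral do rewrite gee0_abs//.
have ig : lam.-integrable setT g.
  by apply/integrableP; split=> //; under eq_integral do rewrite gee0_abs//; rewrite Igh.
have H : {ae lam, forall x, (h \- g)%E x = 0%E}.
  apply: ge0_integral_eq0; first exact: emeasurable_funB.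
    by move=> x; rewrite sube_ge0 ?hfin ?orbT//; exact: gh.
  rewrite integralB// Igh subee// ge0_fin_numE//.
  by apply: integral_ge0 => x _; exact: h0.
move: H; apply: lebesgue_ae_imp => x /eqP; by rewrite sube_eq ?hfin// add0e => /eqP.
Qed.

Lemma superlevel_le F H (t : R) : measurable [set x | t < H x] ->
  lam [set y | t < F y] \is a fin_num ->
  (forall x, t < H x -> ((2 * `|x|)%:E < lam [set y | t < F y]%R)%E) ->
  (lam [set x | t < H x]%R <= lam [set y | t < F y]%R)%E.
Proof.
move=> mH Ffin HF; rewrite -(fineK Ffin).
apply: lebesgue_measure_diam => //; first by rewrite fine_ge0.
move=> a b /= /HF Ha /HF Hb ab.
move: Ha Hb; rewrite -(fineK Ffin) !lte_fin => Ha Hb.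
have := ler_norm b; have := ler_norm (- a); rewrite normrN; lra.
Qed.

(** The slice at height [t] of the region above [h] and below [g], in the form in which it occurs in
    [layer_cake]. *)
Definition slab (g h : R -> R) t : set R := [set x | (h x <= t) && (t < g x)].

Lemma measurable_slab_fun (g h : R -> R) t : measurable_fun setT g ->
  measurable_fun setT h -> measurable_fun setT (fun x => (h x <= t) && (t < g x)).
Proof.
move=> mg mh; apply: measurable_and.
  exact: measurable_fun_ler.
exact: measurable_fun_ltr.
Qed.

Lemma measurable_slab (g h : R -> R) t : measurable_fun setT g ->
  measurable_fun setT h -> measurable (slab g h t).
Proof. by move=> mg mh; apply: measurable_setP; exact: measurable_slab_fun. Qed.

Lemma slab_set0 (g h : R -> R) t : (forall x, 0 <= h x) -> t < 0 ->
  slab g h t = set0.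
Proof.
move=> h0 t0; rewrite -subset0 => x /= /andP[hx _].
by have := h0 x; lra.
Qed.

Lemma slabE (g h : R -> R) t :
  slab g h t = [set x | t < g x] `\` [set x | t < h x].
Proof.
apply/seteqP; split => x /=; rewrite /slab /=.
  by move=> /andP[hx gx]; split=> //; apply/negP; rewrite -leNgt.
by move=> [-> /negP]; rewrite -leNgt => ->.
Qed.

Lemma slab_fin_num (g h : R -> R) t : density g -> density h ->
  lam (slab g h t) \is a fin_num.
Proof.
move=> dg [mh h0 _ _]; have [mg _ _ _] := dg.
have [t0|t0] := leP 0 t; last by rewrite slab_set0// measure0.
rewrite ge0_fin_numE//; apply: (@le_lt_trans _ _ (lam [set x | t < g x])).
  apply: le_lebesgue_measure; last by move=> x /andP[].
    exact: measurable_slab.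
  exact: measurable_superlevel.
by rewrite -ge0_fin_numE// superlevel_fin_num.
Qed.

Lemma integral_slab_cst (g h : R -> R) t (w : R) : measurable_fun setT g ->
  measurable_fun setT h -> 0 <= w ->
  (\int[lam]_x (w * ((h x <= t) && (t < g x))%:R)%:E = w%:E * lam (slab g h t))%E.
Proof.
move=> mg mh w0; under eq_integral do rewrite EFinM.
have ms := measurable_slab_fun t mg mh.
rewrite ge0_integralZl_EFin//; first by rewrite integral_bool_natr.
by apply/measurable_EFinP; exact: measurable_bool_natr.
Qed.

Definition slab_torsion (g h : R -> R) t : \bar R :=
  (\int[lam]_x (torsion x * ((h x <= t) && (t < g x))%:R)%:E)%E.

Lemma slab_torsion_le (g h : R -> R) t (w : R) : measurable_fun setT g ->
  measurable_fun setT h -> 0 <= w -> (forall x, slab g h t x -> torsion x <= w) ->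
  (slab_torsion g h t <= w%:E * lam (slab g h t))%E.
Proof.
move=> mg mh w0 Ww; rewrite -integral_slab_cst//.
have ms : measurable_fun setT (fun x => ((h x <= t) && (t < g x))%:R : R).
  exact: measurable_bool_natr (measurable_slab_fun t mg mh).
apply: ge0_le_integral => //.
- by move=> x _; rewrite lee_fin mulr_ge0// torsion_ge0.
- by apply/measurable_EFinP; apply: measurable_funM => //; exact: measurable_torsion.
- by apply/measurable_EFinP; apply: measurable_funM.
move=> x _; rewrite lee_fin.
have [Sx|_] := boolP ((h x <= t) && (t < g x)); last by rewrite !mulr0.
by rewrite !mulr1 Ww.
Qed.

Lemma slab_torsion_fin_num (g h : R -> R) t : density g -> density h ->
  slab_torsion g h t \is a fin_num.
Proof.
move=> dg dh; have [mg _ _ _] := dg; have [mh _ _ _] := dh.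
have [M M0 WM] := @torsion_le R.
rewrite ge0_fin_numE; last first.
  by apply: integral_ge0 => x _; rewrite lee_fin mulr_ge0// torsion_ge0.
apply: (le_lt_trans (slab_torsion_le mg mh M0 (fun x _ => WM x))).
by rewrite -(fineK (slab_fin_num t dg dh)) -EFinM ltry.
Qed.

Lemma slab_torsion_neg (g h : R -> R) t : (forall x, 0 <= h x) -> t < 0 ->
  slab_torsion g h t = 0%E.
Proof.
move=> h0 t0; apply: integral0_eq => x _; have hx := h0 x.
by rewrite (_ : (h x <= t) = false) ?mulr0//; apply/negbTE; rewrite -ltNge; lra.
Qed.

Let measurable_diff (g h : R -> R) : measurable_fun setT g ->
  measurable_fun setT h -> measurable_fun setT (fun x => Num.max (g x - h x) 0).
Proof. by move=> mg mh; apply: measurable_maxr => //; exact: measurable_funB. Qed.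

(** With weight 1 the layer cake makes the integral of the positive part of [g - h] equal to that of
    the measures of the slabs, here 0. *)
Lemma le_of_null_slabs (g h : R -> R) : density g -> density h ->
  {ae lam, forall t, lam (slab g h t) = 0%E} -> {ae lam, forall x, g x <= h x}.
Proof.
move=> [mg g0 _ _] [mh h0 _ _] Sgh.
have := @layer_cake R (cst 1) g h (measurable_cst _) mg mh (fun=> ler01).
have -> : (\int[lam]_t \int[lam]_x (cst 1 x * ((h x <= t) && (t < g x))%:R)%:E =
    \int[lam]_t (cst 0 t))%E.
  apply: ge0_ae_eq_integral => //.
  - exact: measurable_slab_integral.
  - by move=> t _; apply: integral_ge0 => x _; rewrite lee_fin mulr_ge0.
  apply: lebesgue_ae_imp Sgh => t St _; rewrite integral_slab_cst//.
  by rewrite [lam _]St mule0.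
rewrite integral_cst// mul0e => /ge0_integral_eq0 gh0.
apply: lebesgue_ae_imp (gh0 _ _) => [x||].
- rewrite mul1r => ghx0; have ghx := EFin_inj ghx0.
  have : g x - h x <= Num.max (g x - h x) 0 by rewrite le_max lexx.
  rewrite ghx; lra.
- by apply/measurable_EFinP => /=; apply: measurable_funM => //; exact: measurable_diff.
- by move=> x; rewrite lee_fin mulr_ge0// le_max lexx orbT.
Qed.

Let excess (g h : R -> R) : \bar R :=
  (\int[lam]_x (torsion x * Num.max (g x - h x) 0)%:E)%E.

Let measurable_torsionM (g : R -> R) : measurable_fun setT g ->
  measurable_fun setT (fun x => (torsion x * g x)%:E).
Proof.
move=> mg; apply/measurable_EFinP; apply: measurable_funM => //.
exact: measurable_torsion.
Qed.

Let excessD (g h : R -> R) : density g -> density h ->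
  (excess g h + \int[lam]_x (torsion x * h x)%:E =
   \int[lam]_x (torsion x * Num.max (g x) (h x))%:E)%E.
Proof.
move=> [mg g0 _ _] [mh h0 _ _]; rewrite -ge0_integralD//.
- apply: eq_integral => x _; rewrite -EFinD -mulrDr; congr ((_ * _)%:E).
  by rewrite /Num.max; case: ifP; case: ifP; lra.
- by move=> x _; rewrite lee_fin mulr_ge0 ?torsion_ge0// le_max lexx orbT.
- by apply: measurable_torsionM; exact: measurable_diff.
- by move=> x _; rewrite lee_fin mulr_ge0 ?torsion_ge0.
- exact: measurable_torsionM.
Qed.

Let excess_fin (g h : R -> R) : density g -> density h -> (excess g h < +oo)%E.
Proof.
move=> dg dh; have [mg g0 _ _] := dg; have [mh h0 _ _] := dh.
apply: le_lt_trans (integral_torsion_fin dg); apply: ge0_le_integral => //.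
- by move=> x _; rewrite lee_fin mulr_ge0 ?torsion_ge0// le_max lexx orbT.
- by apply: measurable_torsionM; exact: measurable_diff.
- exact: measurable_torsionM.
move=> x _; rewrite lee_fin ler_wpM2l ?torsion_ge0// ge_max g0 andbT.
by rewrite lerBlDr lerDl.
Qed.

(** Adding the integral of [torsion * h] to [excess g h] gives an integral of [Num.max (g x) (h x)],
    symmetric in the two densities; the equal finite terms then cancel, with no subtraction of
    possibly infinite quantities. *)
Let excess_eq (g h : R -> R) : density g -> density h ->
  (\int[lam]_x (torsion x * g x)%:E = \int[lam]_x (torsion x * h x)%:E)%E ->
  excess g h = excess h g.
Proof.
move=> dg dh gh; have := excessD dg dh.
have -> : (\int[lam]_x (torsion x * Num.max (g x) (h x))%:E =
           \int[lam]_x (torsion x * Num.max (h x) (g x))%:E)%E.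
  by apply: eq_integral => x _; rewrite maxC.
have fin u v : density u -> density v -> excess u v \is a fin_num.
  move=> du dv; rewrite ge0_fin_numE ?excess_fin//.
  by apply: integral_ge0 => x _; rewrite lee_fin mulr_ge0 ?torsion_ge0// le_max lexx orbT.
have hfin : (\int[lam]_x (torsion x * h x)%:E)%E \is a fin_num.
  have [_ h0 _ _] := dh; rewrite ge0_fin_numE ?integral_torsion_fin//.
  by apply: integral_ge0 => x _; rewrite lee_fin mulr_ge0 ?torsion_ge0.
rewrite -excessD// gh -(fineK hfin) -(fineK (fin _ _ dg dh)) -(fineK (fin _ _ dh dg)).
by rewrite -!EFinD => -[] /addIr ->.
Qed.

Section same_distribution.
Variables F H : R -> R.
Hypotheses (dF : density F) (dH : density H) (F00 : F 0 = 0).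
Hypothesis FH : forall t x, 0 <= t -> x != 0 ->
  ((2 * `|x|)%:E < lam [set y | t < F y]%R)%E -> t < H x.
Hypothesis HF : forall t x, 0 <= t -> t < H x ->
  ((2 * `|x|)%:E < lam [set y | t < F y]%R)%E.

Let mF : measurable_fun setT F. Proof. by case: dF. Qed.
Let mH : measurable_fun setT H. Proof. by case: dH. Qed.
Let F0 x : 0 <= F x. Proof. by case: dF. Qed.
Let H0 x : 0 <= H x. Proof. by case: dH. Qed.
Let Fout x : ~ Ipi x -> F x = 0. Proof. by case: dF => ? ? + ?; apply. Qed.
Let Hout x : ~ Ipi x -> H x = 0. Proof. by case: dH => ? ? + ?; apply. Qed.

Lemma equimeasurable t : 0 <= t -> lam [set x | t < H x] = lam [set x | t < F x].
Proof.
move=> t0; apply/eqP; rewrite eq_le; apply/andP; split.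
  apply: superlevel_le; [exact: measurable_superlevel|exact: superlevel_fin_num|].
  by move=> x; exact: HF.
apply: (@lebesgue_measure_le_centered _ _ _ (fine (lam [set y | t < F y]) / 2)).
- exact: measurable_superlevel.
- exact: measurable_superlevel.
- by rewrite mulrC divfK// fineK// superlevel_fin_num.
move=> a b x _ _ _ _ x0 xc; apply: FH => //.
by rewrite -(fineK (superlevel_fin_num dF t0)) lte_fin; lra.
Qed.

Lemma slab_eq t : lam (slab F H t) = lam (slab H F t).
Proof.
have [t0|t0] := leP 0 t; last by rewrite !slab_set0.
have mFt := @measurable_superlevel _ F t mF; have mHt := @measurable_superlevel _ H t mH.
have := equimeasurable t0.
rewrite (lebesgue_measureDI mHt mFt) (lebesgue_measureDI mFt mHt) -!slabE setIC.
set J := lam (_ `&` _).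
have Jfin : J \is a fin_num.
  rewrite ge0_fin_numE; last exact: measure_ge0.
  apply: (@le_lt_trans _ _ (lam [set x | t < F x])).
    by apply: le_lebesgue_measure; [exact: measurableI|by []|move=> x []].
  by rewrite -ge0_fin_numE// superlevel_fin_num.
rewrite -(fineK Jfin) -(fineK (slab_fin_num t dH dF)) -(fineK (slab_fin_num t dF dH)).
by rewrite -!EFinD => -[] /addIr ->.
Qed.

(** Half the length of the centred interval {H > t}; [torsion (radius t)] is the threshold that
    separates the two slabs at height [t]. *)
Let radius t : R := fine (lam [set y | t < F y]) / 2.

Let radius_Ipi t : 0 <= t -> Ipi (radius t).
Proof.
move=> t0; have p0 := pi_gt0 R.
have : 0 <= fine (lam [set y | t < F y]) by rewrite fine_ge0.
have : fine (lam [set y | t < F y]) <= 2 * pi.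
  rewrite -lee_fin fineK ?superlevel_fin_num// -lebesgue_measure_Ipi.
  apply: le_lebesgue_measure; [exact: measurable_superlevel|exact: measurable_Ipi|].
  move=> x /= tFx; apply: contrapT => /Fout Fx0; lra.
by rewrite /radius => h1 h2; apply/IpiP; lra.
Qed.

Let radius_ge0 t : 0 <= radius t.
Proof. by rewrite divr_ge0// fine_ge0. Qed.

Let torsion_outside t x : 0 <= t -> slab F H t x -> torsion x <= torsion (radius t).
Proof.
move=> t0 /andP[Hx Fx].
(* [FH] is silent at the centre, so [F 0 = 0] is what keeps the centre out of this slab. *)
have x0 : x != 0 by apply/eqP => x0; move: Fx; rewrite x0 F00; lra.
have Dx : Ipi x by apply: contrapT => /Fout Fx0; lra.
have Dr := radius_Ipi t0.
rewrite !torsionE//; apply: ug_one_le => //.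
rewrite ger0_norm ?radius_ge0// leNgt; apply/negP => xr.
suff : t < H x by lra.
apply: FH => //; rewrite -(fineK (superlevel_fin_num dF t0)) lte_fin.
by move: xr; rewrite /radius; lra.
Qed.

Let torsion_inside t x : 0 <= t -> slab H F t x -> torsion (radius t) < torsion x.
Proof.
move=> t0 /andP[_ Hx].
have Dx : Ipi x by apply: contrapT => /Hout Hx0; lra.
have Dr := radius_Ipi t0.
rewrite !torsionE//; apply: ug_one_lt => //.
rewrite [ltRHS]ger0_norm ?radius_ge0//.
have := HF t0 Hx; rewrite -(fineK (superlevel_fin_num dF t0)) lte_fin.
by rewrite /radius; lra.
Qed.

(** What the torsion function gains over the threshold on the slab of [H] above [F]. It is strictly
    positive there, so its integral detects the measure of that slab. *)
Let surplus t x := Num.max (torsion x - torsion (radius t)) 0 *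
  ((F x <= t) && (t < H x))%:R.

Let surplus_ge0 t x : 0 <= surplus t x.
Proof. by rewrite mulr_ge0// le_max lexx orbT. Qed.

Let measurable_surplus t : measurable_fun setT (fun x => (surplus t x)%:E).
Proof.
apply/measurable_EFinP; apply: measurable_funM.
  apply: measurable_maxr => //; apply: measurable_funB => //.
  exact: measurable_torsion.
exact: measurable_bool_natr (measurable_slab_fun t mH mF).
Qed.

Let slab_torsion_surplus t : 0 <= t ->
  (slab_torsion H F t = (torsion (radius t))%:E * lam (slab F H t) +
                        \int[lam]_x (surplus t x)%:E)%E.
Proof.
move=> t0; rewrite slab_eq -integral_slab_cst ?torsion_ge0// -ge0_integralD//.
- apply: eq_integral => x _; rewrite -EFinD; congr EFin; rewrite /surplus.
  have [Sx|_] := boolP ((F x <= t) && (t < H x)); last by rewrite !mulr0 addr0.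
  rewrite !mulr1 max_l; first by ring.
  by rewrite subr_ge0 ltW// torsion_inside.
- by move=> x _; rewrite lee_fin mulr_ge0// torsion_ge0.
- apply/measurable_EFinP; apply: measurable_funM => //.
  exact: measurable_bool_natr (measurable_slab_fun t mH mF).
- by move=> x _; rewrite lee_fin.
- exact: measurable_surplus.
Qed.

Let slab_torsion_FH t : 0 <= t ->
  (slab_torsion F H t <= (torsion (radius t))%:E * lam (slab F H t))%E.
Proof.
move=> t0; apply: slab_torsion_le => //; first exact: torsion_ge0.
by move=> x; exact: torsion_outside.
Qed.

Let slab_torsion_mono t : (slab_torsion F H t <= slab_torsion H F t)%E.
Proof.
have [t0|t0] := leP 0 t; last by rewrite !slab_torsion_neg.
rewrite slab_torsion_surplus//; apply: le_trans (slab_torsion_FH t0) _.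
by rewrite leeDl// integral_ge0// => x _; rewrite lee_fin.
Qed.

(** Both slabs have the same measure. The torsion integral is at most threshold times measure on
    one, and exceeds it by the integral of [surplus] on the other; equality makes [surplus] vanish
    almost everywhere, hence the slab is null. *)
Let null_slab t : slab_torsion F H t = slab_torsion H F t -> lam (slab F H t) = 0%E.
Proof.
have [t0|t0] := leP 0 t; last by rewrite slab_set0// measure0.
rewrite slab_torsion_surplus// => slabE'.
have := slab_torsion_FH t0; rewrite slabE'.
rewrite -(fineK (slab_fin_num t dF dH)) -EFinM.
have surplus0 : (0 <= \int[lam]_x (surplus t x)%:E)%E.
  by apply: integral_ge0 => x _; rewrite lee_fin.
rewrite -leeBrDl// subee// => surplus_le.
have surplus_ae : {ae lam, forall x, (surplus t x)%:E = 0%E}.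
  apply: ge0_integral_eq0; first exact: measurable_surplus.
    by move=> x; rewrite lee_fin.
  by apply/eqP; rewrite eq_le surplus_le.
rewrite (fineK (slab_fin_num t dF dH)) slab_eq.
apply: lebesgue_measure_negligible0; first exact: measurable_slab.
move: surplus_ae; apply: negligibleS => x Sx /= sx; move: (EFin_inj sx).
have := torsion_inside t0 Sx; rewrite /surplus Sx mulr1 => Wx.
rewrite max_l; lra.
Qed.

(* The torsion function is strictly decreasing in |x|, so the centred
   superlevel sets of H are the only ones maximising its integral. *)
Lemma ae_eq_of_mean_eq :
  (\int[lam]_(x in Ipi) (ug F x)%:E = \int[lam]_(x in Ipi) (ug H x)%:E)%E ->
  {ae lam, forall x, F x = H x}.
Proof.
rewrite !integral_ug// => /(excess_eq dF dH) excessE.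
(* By the layer cake the two excesses are integrals over [t] of slab torsions, one of which
   dominates the other at each height; equal finite integrals give equality for almost every [t]. *)
have slab_ae : {ae lam, forall t, slab_torsion F H t = slab_torsion H F t}.
  apply: le_integral_eq.
  - by apply: measurable_slab_integral => //; [exact: measurable_torsion|exact: torsion_ge0].
  - by apply: measurable_slab_integral => //; [exact: measurable_torsion|exact: torsion_ge0].
  - by move=> t; apply: integral_ge0 => x _; rewrite lee_fin mulr_ge0// torsion_ge0.
  - exact: slab_torsion_mono.
  - by move=> t; exact: slab_torsion_fin_num.
  - by rewrite -!layer_cake//; first [exact: measurable_torsion|exact: torsion_ge0].
  - rewrite -layer_cake//;
      first [exact: excess_fin|exact: measurable_torsion|exact: torsion_ge0].
have S_ae : {ae lam, forall t, lam (slab F H t) = 0%E}.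
  by apply: lebesgue_ae_imp slab_ae => t; exact: null_slab.
have FH_le := le_of_null_slabs dF dH S_ae.
have HF_le : {ae lam, forall x, H x <= F x}.
  by apply: (le_of_null_slabs dH dF); apply: lebesgue_ae_imp S_ae => t; rewrite slab_eq.
apply: lebesgue_ae_imp (lebesgue_ae_and FH_le HF_le) => x [xle xge].
by apply/eqP; rewrite eq_le xle.
Qed.

End same_distribution.
End equality_case.

(** * Properties of the symmetric decreasing rearrangement *)

Section symmetric_rearrangement.
Context {R : realType}.
Local Notation lam := (@lebesgue_measure R).
Local Notation Ipi := (@Ipi R).
Implicit Types (x y t : R).

Definition Ipunctured : set R := [set x | (x != 0) && (`|x| < pi)].

Lemma IpuncturedE : Ipunctured = `]- pi, 0%R[%classic `|` `]0%R, pi[%classic.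
Proof.
apply/seteqP; split => x /=; rewrite !in_itv/=.
  move=> /andP[x0 xpi]; move: xpi; rewrite ltr_norml => /andP[x1 x2].
  have [x3|x3|x3] := ltgtP x 0; [left|right|by rewrite x3 eqxx in x0].
    by rewrite x1.
  by rewrite x2.
have p0 := pi_gt0 R.
by case=> /andP[x1 x2]; rewrite /Ipunctured /= ltr_norml; apply/andP; split;
  [rewrite lt_eqF|apply/andP; split|rewrite gt_eqF|apply/andP; split] => //; lra.
Qed.

Lemma measurable_Ipunctured : measurable Ipunctured.
Proof. by rewrite IpuncturedE; apply: measurableU; exact: measurable_itv. Qed.

Lemma Ipunctured_sub : Ipunctured `<=` Ipi.
Proof. by move=> x /andP[_ /ltW]; rewrite ler_norml => ?; exact/IpiP. Qed.

Lemma Ipunctured_ae : {ae lam, forall x, Ipi x -> Ipunctured x}.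
Proof.
have N1 (a : R) : lam.-negligible [set a].
  by exists [set a]; split => //; exact: lebesgue_measure_set1.
have := negligibleU (negligibleU (N1 0) (N1 pi)) (N1 (- pi)).
apply: negligibleS => x /= /not_implyP[/IpiP/andP[x1 x2] /negP].
rewrite negb_and negbK -leNgt => /orP[/eqP ->|]; first by left; left.
rewrite real_ler_normr ?num_real// => /orP[] ?; [left; right|right] => /=; lra.
Qed.

(* The points 0 and +-pi are left out because drearr has junk values at the two
   ends, [fine] turning an infinite essential supremum into 0. *)
Definition nonneg_patch (f : R -> R) : R -> R :=
  (fun x => Num.max (f x) 0) \_ Ipunctured.

Definition sdrearr_patch (f : R -> R) : R -> R := sdrearr f \_ Ipunctured.

Variable f : R -> R.
Hypothesis f_int : lam.-integrable Ipi (EFin \o f).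
Hypothesis f_ge0 : {ae lam, forall x, Ipi x -> 0 <= f x}.

Local Notation F := (nonneg_patch f).
Local Notation H := (sdrearr_patch f).

Lemma nonneg_patch_ae : {ae lam, forall x, Ipi x -> f x = F x}.
Proof.
apply: lebesgue_ae_imp (lebesgue_ae_and f_ge0 Ipunctured_ae) => x [fx Jx] Dx.
by rewrite /nonneg_patch patchE mem_set ?max_l//; [exact: fx|exact: Jx].
Qed.

Lemma sdrearr_patch_ae : {ae lam, forall x, Ipi x -> sdrearr f x = H x}.
Proof.
apply: lebesgue_ae_imp Ipunctured_ae => x Jx Dx.
by rewrite /sdrearr_patch patchE mem_set//; exact: Jx.
Qed.

Let mf : measurable_fun Ipi f.
Proof. by apply/measurable_EFinP; exact: measurable_int f_int. Qed.

Let mF : measurable_fun setT F.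
Proof.
apply/(measurable_restrictT _ measurable_Ipunctured).
apply: measurable_maxr => //.
exact: measurable_funS measurable_Ipi Ipunctured_sub mf.
Qed.

Lemma nonneg_patch_ge0 x : 0 <= F x.
Proof. by rewrite /nonneg_patch patchE; case: ifP => // _; rewrite le_max lexx orbT. Qed.

Lemma density_nonneg_patch : density F.
Proof.
split => //; first exact: nonneg_patch_ge0.
  move=> x Dx; rewrite /nonneg_patch patchE memNset//.
  exact: contra_not (@Ipunctured_sub x) Dx.
rewrite -(integral_Ipi (g := F)); last first.
  move=> x Dx; rewrite /nonneg_patch patchE memNset//.
  exact: contra_not (@Ipunctured_sub x) Dx.
have /integrableP[_] := f_int; apply: le_lt_trans.
apply: ge0_le_integral => //=.
- exact: measurable_Ipi.
- by move=> x _; rewrite lee_fin nonneg_patch_ge0.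
- by apply/measurable_EFinP; exact: measurable_funTS.
- by apply/measurable_EFinP; apply: measurableT_comp.
move=> x _; rewrite lee_fin /nonneg_patch patchE; case: ifP => _; last exact: normr_ge0.
by rewrite ge_max ler_norm normr_ge0.
Qed.

Lemma le_lebesgue_ae (A B : set R) : measurable A -> measurable B ->
  {ae lam, forall x, A x -> B x} -> (lam A <= lam B)%E.
Proof.
move=> mA mB AB.
have N : lam.-negligible (A `\` B).
  by move: AB; apply: negligibleS => x [Ax Bx] /= /(_ Ax).
rewrite (lebesgue_measureDI mA mB) (lebesgue_measure_negligible0 (measurableD mA mB) N) add0e.
by apply: le_lebesgue_measure => [||x []//]; [exact: measurableI|].
Qed.

Let mlev t : measurable (Ipi `&` [set x | t < f x]).
Proof.
rewrite -preimage_itvoy; exact: mf measurable_Ipi _ (measurable_itv _).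
Qed.

Let mlevF t : measurable [set x | t < F x].
Proof. exact: measurable_superlevel. Qed.

Lemma superlevel_nonneg_patch t : 0 <= t ->
  lam (Ipi `&` [set x | t < f x]) = lam [set x | t < F x].
Proof.
move=> t0; apply/eqP; rewrite eq_le; apply/andP; split; apply: le_lebesgue_ae => //.
  by apply: lebesgue_ae_imp nonneg_patch_ae => x fF [Dx /=]; rewrite fF.
apply: lebesgue_ae_imp nonneg_patch_ae => x fF /= tF.
have Dx : Ipi x by apply: contrapT => Dx;
  have [_ _ /(_ x Dx) F0 _] := density_nonneg_patch; lra.
by split => //=; rewrite fF.
Qed.

Lemma superlevel_neg t : t < 0 -> lam (Ipi `&` [set x | t < f x]) = (2 * pi)%:E.
Proof.
move=> t0; rewrite -lebesgue_measure_Ipi; apply/eqP; rewrite eq_le; apply/andP; split.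
  by apply: le_lebesgue_measure => //; exact: measurable_Ipi.
apply: le_lebesgue_ae => //; first exact: measurable_Ipi.
by apply: lebesgue_ae_imp f_ge0 => x fx Dx; split => //=; have := fx Dx; lra.
Qed.

(** The set whose infimum is the rearrangement at [x]. The next two lemmas show it bounded below and
    nonempty, without which [inf] would be a default value: |x| < pi gives the bound, x != 0 the
    point. *)
Let level x : set R := [set s | (lam (Ipi `&` [set y | (s < f y)%R]) <= (2 * `|x|)%:E)%E].

Lemma level_lbound x : Ipunctured x -> lbound (level x) 0.
Proof.
move=> /andP[_ xpi] s /=; rewrite /level/=; apply: contraTT; rewrite -!ltNge => s0.
by rewrite superlevel_neg// lte_fin ltr_pM2l.
Qed.

Lemma level_nonempty x : Ipunctured x -> level x !=set0.
Proof.
move=> /andP[x0 _]; have [_ F0 _ Ffin] := density_nonneg_patch.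
have xgt0 : 0 < 2 * `|x| by rewrite mulr_gt0// normr_gt0.
pose M := fine (\int[lam]_x (F x)%:E)%E.
have ME : (\int[lam]_x (F x)%:E = M%:E)%E.
  by rewrite fineK// ge0_fin_numE// integral_ge0// => y _; rewrite lee_fin.
have M0 : 0 <= M by rewrite -lee_fin -ME integral_ge0// => y _; rewrite lee_fin.
(* Markov gives s lam{F > s} <= M < M + 1 = 2 s |x|. *)
pose s := (M + 1) / (2 * `|x|).
have s0 : 0 < s by rewrite divr_gt0//; lra.
exists s; rewrite /level/= superlevel_nonneg_patch; last exact: ltW.
have markov : (s%:E * lam [set y | s < F y]%R <= M%:E)%E.
  have mS : measurable_fun setT (fun y => s < F y) by exact: measurable_fun_ltr.
  have mS1 : measurable_fun setT (fun y => (s < F y)%R%:R : R) by exact: measurable_bool_natr.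
  rewrite -ME -(integral_bool_natr lam mS) -ge0_integralZl_EFin//; last 2 first.
  - exact/measurable_EFinP.
  - exact: ltW.
  apply: ge0_le_integral => //.
  - by move=> y _; rewrite -EFinM lee_fin mulr_ge0// ltW.
  - by apply: measurable_funeM; exact/measurable_EFinP.
  - exact/measurable_EFinP.
  move=> y _; rewrite -EFinM lee_fin.
  by case: ltP => sF; [rewrite mulr1 ltW|rewrite mulr0].
have Sfin := superlevel_fin_num density_nonneg_patch (ltW s0).
move: markov; rewrite -(fineK Sfin) -EFinM !lee_fin => markov.
rewrite leNgt; apply/negP => lt_fine.
have : s * (2 * `|x|) < s * fine (lam [set y | s < F y]) by rewrite ltr_pM2l.
by rewrite /s divfK ?gt_eqF//; rewrite -/s; lra.
Qed.

(** Right continuity of the distribution function, by continuity of the measure along the increasing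
    sets {f > t + 1/(n+1)}. *)
Lemma superlevel_right t (c : \bar R) : (c < lam (Ipi `&` [set x | t < f x]%R))%E ->
  exists2 s, t < s & (c < lam (Ipi `&` [set x | s < f x]%R))%E.
Proof.
move=> ct; apply: contrapT => /forall2NP nex.
pose A (n : nat) := Ipi `&` [set x | t + n.+1%:R^-1 < f x].
have AU : \bigcup_n A n = Ipi `&` [set x | t < f x].
  apply/seteqP; split => [x [n _ [Dx /= Ax]]|x [Dx /= tf]].
    by split => //=; apply: lt_trans Ax; rewrite ltrDl invr_gt0.
  by have [n tn] := ltr_add_invr tf; exists n.
have := @nondecreasing_cvg_mu _ _ _ lam A (fun n => mlev _).
rewrite AU => /(_ (mlev t)) cv.
have {cv}: lam \o A @ \oo --> lam (Ipi `&` [set x | t < f x]).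
  apply: cv => m n mn; apply/subsetPset => x [Dx /= Ax]; split => //=.
  by apply: le_lt_trans Ax; rewrite lerD2l lef_pV2 ?posrE// ler_nat.
move=> cv; have : (lam (Ipi `&` [set x | (t < f x)%R]) <= c)%E.
  apply: (@closed_cvg _ _ \oo eventually_filter _ (fun v => (v <= c)%E) _ _ _ cv).
    exact: closed_ereal_ge_ereal.
  apply: nearW => n /=.
  have [/negP|/negP] := nex (t + n.+1%:R^-1); last by rewrite -leNgt.
  by rewrite ltrDl invr_gt0 ltr0n.
by rewrite leNgt ct.
Qed.

(** The infimum is turned into an equivalence between strict inequalities. From right to left,
    [superlevel_right] supplies an [s > t] below the whole level set; without this margin the
    infimum could equal [t]. *)
Lemma sdrearr_gt t x : Ipunctured x ->
  (t < sdrearr f x <-> ((2 * `|x|)%:E < lam (Ipi `&` [set y | t < f y]%R))%E).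
Proof.
move=> Jx; have /andP[x0 xpi] := Jx.
have -> : sdrearr f x = inf (level x).
  rewrite /sdrearr /drearr ifF; last by apply/negbTE; rewrite mulf_neq0 ?normr_eq0.
  by rewrite ifF//; apply/negbTE; rewrite neq_lt ltr_pM2l ?xpi.
have [ne lb] := (level_nonempty Jx, level_lbound Jx).
split => [tinf|/superlevel_right[s ts xs]].
  rewrite ltNge; apply/negP => tl; have : inf (level x) <= t.
    by apply: ge_inf => //; exists 0.
  lra.
apply: (lt_le_trans ts); apply: lb_le_inf => // r /= lr.
rewrite leNgt; apply/negP => rs.
have : (lam (Ipi `&` [set y | (s < f y)%R]) <= lam (Ipi `&` [set y | (r < f y)%R]))%E.
  by apply: le_lebesgue_measure => // y [Dy /= sf]; split => //=; exact: lt_trans sf.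
by move=> /(lt_le_trans xs); rewrite ltNge lr.
Qed.

Lemma sdrearr_patch_gt t x : 0 <= t ->
  (t < H x <-> Ipunctured x /\ ((2 * `|x|)%:E < lam [set y | t < F y]%R)%E).
Proof.
move=> t0; rewrite -superlevel_nonneg_patch// /sdrearr_patch patchE.
case: ifPn => [/set_mem Jx|/negP Jx].
  by split => [/(sdrearr_gt t Jx)|[_ /(sdrearr_gt t Jx)]].
split => [|[Jx' _]]; first by move=> /lt_le_trans/(_ t0); rewrite ltxx.
by exfalso; apply: Jx; exact: mem_set.
Qed.

Lemma sdrearr_patch_ge0 x : 0 <= H x.
Proof.
rewrite /sdrearr_patch patchE; case: ifPn => // /set_mem Jx.
rewrite leNgt; apply/negP => sx.
(* Half of a negative value is larger, yet its superlevel set has full measure 2 pi > 2|x|, which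
   would place it below the value itself. *)
have : sdrearr f x / 2 < sdrearr f x.
  apply/(sdrearr_gt _ Jx); rewrite superlevel_neg; last lra.
  by rewrite lte_fin ltr_pM2l//; case/andP: Jx.
lra.
Qed.

Lemma sdrearr_patchN x : H (- x) = H x.
Proof.
have JN y : Ipunctured y -> Ipunctured (- y).
  by move=> /andP[y0 yp]; apply/andP; rewrite oppr_eq0 normrN.
rewrite /sdrearr_patch !patchE /sdrearr normrN.
have -> // : (- x \in Ipunctured) = (x \in Ipunctured).
by apply/idP/idP => /set_mem/JN; rewrite ?opprK => ?; exact/mem_set.
Qed.

Lemma measurable_sdrearr_patch : measurable_fun setT H.
Proof.
apply: (measurability (@RGenOInfty.G R)) => [|/= _ [_] [r] -> <-].
  exact: RGenOInfty.measurableE.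
rewrite setTI preimage_itvoy; have [r0|r0] := leP 0 r; last first.
  rewrite (_ : [set x | _] = setT)//; apply/seteqP; split => x //= _.
  exact: lt_le_trans r0 (sdrearr_patch_ge0 x).
rewrite (_ : [set x | _] = Ipunctured `&`
    [set x | ((2 * `|x|)%:E < lam [set y | r < F y]%R)%E]); last first.
  by apply/seteqP; split => x /=; [move/(sdrearr_patch_gt x r0)|move=> ?; exact/sdrearr_patch_gt].
apply: measurableI; first exact: measurable_Ipunctured.
have Ffin := superlevel_fin_num density_nonneg_patch r0.
rewrite -(fineK Ffin); set c := fine _.
apply: (@measurable_setP _ _ (fun x => ((2 * `|x|)%:E < c%:E)%E)).
rewrite (_ : (fun _ => _) = (fun x => 2 * `|x| < c)); last first.
  by apply/funext => x; rewrite lte_fin.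
by apply: measurable_fun_ltr => //; apply: measurable_funM.
Qed.

Lemma density_sdrearr_patch : density H.
Proof.
have [_ F0 _ Ffin] := density_nonneg_patch.
split; [exact: measurable_sdrearr_patch|exact: sdrearr_patch_ge0| |].
  move=> x Dx; rewrite /sdrearr_patch patchE memNset//.
  exact: contra_not (@Ipunctured_sub x) Dx.
apply: le_lt_trans Ffin.
have mul1 (g : R -> R) : (\int[lam]_x (g x)%:E = \int[lam]_x (cst 1 x * g x)%:E)%E.
  by apply: eq_integral => x _; rewrite mul1r.
rewrite (mul1 H) (mul1 F); apply: le_integral_levels => //.
- exact: measurable_sdrearr_patch.
- by move=> x; exact: sdrearr_patch_ge0.
move=> s t _ t0 /=; have [s1|s1] /= := ltP s 1; last first.
  exact: lexx.
apply: (@superlevel_le _ F H t).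
- exact: measurable_superlevel measurable_sdrearr_patch.
- exact: superlevel_fin_num density_nonneg_patch t0.
by move=> x /(sdrearr_patch_gt x t0)[].
Qed.

(** The three exceptional points are split off as singletons, on which measurability holds whatever
    the values there. *)
Lemma measurable_sdrearr : measurable_fun Ipi (sdrearr f).
Proof.
have -> : Ipi = Ipunctured `|` ([set 0] `|` ([set pi] `|` [set - pi])).
  have p0 := pi_gt0 R.
  apply/seteqP; split => x.
    move=> /IpiP/andP[x1 x2]; rewrite /Ipunctured /=.
    have [->|x0] := eqVneq x 0; first by right; left.
    have [->|xp] := eqVneq x pi; first by right; right; left.
    have [->|xn] := eqVneq x (- pi); first by right; right; right.
    left; apply/andP; split => //.
    by rewrite ltr_norml !lt_neqAle xp x1 x2 !andbT eq_sym.
  by move=> [/Ipunctured_sub//|/= [->|[->|->]]]; apply/IpiP; lra.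
have m1 := @measurable_fun_set1 _ _ R R.
apply/measurable_funU => //.
- exact: measurable_Ipunctured.
- by do 2 apply: measurableU => //.
split.
  apply/(measurable_restrictT _ measurable_Ipunctured).
  exact: measurable_sdrearr_patch.
have mpi : measurable ([set pi] `|` [set - pi] : set R) by exact: measurableU.
apply/measurable_funU => //; split; first exact: m1.
by apply/measurable_funU.
Qed.

End symmetric_rearrangement.

(** Changing a density on a null set alters its potential at no point, so the patched functions can
    replace the original ones by plain rewriting. *)
Lemma ug_ae (R : realType) (g h : R -> R) :
  measurable_fun (@Ipi R) g -> measurable_fun (@Ipi R) h ->
  {ae @lebesgue_measure R, forall x, @Ipi R x -> g x = h x} -> ug g = ug h.
Proof.
move=> mg mh gh; apply/funext => x; rewrite /ug /Rintegral; congr fine.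
have mG : measurable_fun (@Ipi R) (Green x).
  apply: measurable_funD => //; apply: measurable_funB.
    by apply: measurable_funM => //; apply: measurable_funN; exact: measurable_funM.
  by apply: measurable_funM => //; apply: measurableT_comp => //; exact: measurable_funB.
apply: ae_eq_integral.
- exact: measurable_Ipi.
- by apply/measurable_EFinP; exact: measurable_funM.
- by apply/measurable_EFinP; exact: measurable_funM.
by apply: lebesgue_ae_imp gh => y gh /gh ->.
Qed.

Theorem theorem5p7 (R : realType) (f : R -> R)
  (f_int : (@lebesgue_measure R).-integrable (@Ipi R) (EFin \o f))
  (f_ge0 : {ae @lebesgue_measure R, forall x, @Ipi R x -> 0 <= f x})
  (f_nz : ~ {ae @lebesgue_measure R, forall x, @Ipi R x -> f x = 0}) :
  (forall phi : R -> R, convex_fun phi -> {homo phi : x y / x <= y} ->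
     (\int[@lebesgue_measure R]_(x in @Ipi R) (phi (ug f x))%:E <=
      \int[@lebesgue_measure R]_(x in @Ipi R) (phi (ug (sdrearr f) x))%:E)%E)
  /\ (forall t : R, 0 <= t -> t <= 2 * pi ->
        (star (ug f) t <= star (ug (sdrearr f)) t)%E)
  /\ (forall phi : R -> R, convex_fun phi -> {homo phi : x y / x < y} ->
       ((\int[@lebesgue_measure R]_(x in @Ipi R) (phi (ug f x))%:E =
         \int[@lebesgue_measure R]_(x in @Ipi R) (phi (ug (sdrearr f) x))%:E)%E
        <-> {ae @lebesgue_measure R, forall x, `]- pi, pi[%classic x ->
                                         f x = sdrearr f x})).
Proof.
have dF := density_nonneg_patch f_int.
have dH := density_sdrearr_patch f_int f_ge0.
have Heven := sdrearr_patchN f.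
have H_gt := sdrearr_patch_gt f_int f_ge0.
have mf : measurable_fun (@Ipi R) f.
  by apply/measurable_EFinP; exact: measurable_int f_int.
have mH := measurable_sdrearr f_int f_ge0.
have ugF : ug f = ug (nonneg_patch f).
  apply: ug_ae => //; last exact: nonneg_patch_ae.
  by have [mF _ _ _] := dF; exact: measurable_funTS.
have ugH : ug (sdrearr f) = ug (sdrearr_patch f).
  apply: ug_ae => //; last exact: sdrearr_patch_ae.
  by have [mH' _ _ _] := dH; exact: measurable_funTS.
(* [|x| < pi], which membership in [Ipunctured] also requires, follows because {F > t} has measure
   at most 2 pi. *)
have FH (t x : R) : 0 <= t -> x != 0 ->
    ((2 * `|x|)%:E < lebesgue_measure [set y | t < nonneg_patch f y]%R)%E ->
    t < sdrearr_patch f x.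
  move=> t0 x0 xt; apply/(H_gt _ _ t0); split=> //; apply/andP; split=> //.
  have : ((2 * `|x|)%:E < (2 * pi)%:E)%E.
    apply: lt_le_trans xt _; rewrite -lebesgue_measure_Ipi.
    have [mF _ Fout _] := dF; apply: le_lebesgue_measure.
    - exact: measurable_superlevel.
    - exact: measurable_Ipi.
    - move=> y /= tF; apply: contrapT => /Fout F0; move: tF; rewrite F0.
      by rewrite ltNge t0.
  by rewrite lte_fin ltr_pM2l.
rewrite !ugF !ugH; split=> [phi _|]; first exact: integral_comp_ug_le.
split=> [t|phi phi_cvx phi_homo]; first exact: star_ug_le.
split=> [phi_eq|f_eq].
  have := integral_ug_eq dF dH Heven FH phi_cvx phi_homo phi_eq.
  have patch0 (g : R -> R) : (g \_ Ipunctured) 0 = 0.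
    by rewrite patchE memNset// => /andP[]; rewrite eqxx.
  move=> /(ae_eq_of_mean_eq dF dH (patch0 _) FH) F_eq_H.
  have {}F_eq_H : {ae lebesgue_measure, forall x, nonneg_patch f x = sdrearr_patch f x}.
    by apply: F_eq_H => t x t0 /(H_gt _ _ t0)[].
  have := lebesgue_ae_and (nonneg_patch_ae f_ge0) (sdrearr_patch_ae f).
  move=> /(lebesgue_ae_and F_eq_H); apply: lebesgue_ae_imp => x [e [fF fH]].
  rewrite /= in_itv/= => /andP[x1 x2].
  have Dx : Ipi x by apply/IpiP; rewrite !ltW.
  by rewrite fF// e fH.
(* Conversely, densities that agree almost everywhere have identical potentials. *)
suff -> : ug (nonneg_patch f) = ug (sdrearr_patch f) by [].
rewrite -ugF -ugH; apply: ug_ae => //.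
have := lebesgue_ae_and f_eq Ipunctured_ae; apply: lebesgue_ae_imp => x [fx Jx] Dx.
by apply: fx; have /andP[_] := Jx Dx; rewrite /= in_itv/= -ltr_norml.
Qed.
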